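(* Let $p>100$ be a prime and let $\alpha\in(0,1)$; put $x=p^{\alpha}$. Write $\omega(m)$ for the number of distinct prime divisors of $m$, and suppose $$\mathrm{Rad}(p-1) = k\,p_1p_2\cdots p_s,$$ where $1\le s\le \omega(p-1)$, $p_1,\dots,p_s$ are distinct primes, and $k$ is the product of the smallest $\omega(p-1)-s$ distinct primes dividing $p-1$. Let $$\delta = 1-\sum_{i=1}^{s}\frac{1}{p_i},$$ suppose $\delta>0$, and let $\Delta = \frac{s-1}{\delta}+2$. Let $$c = \frac{1}{\pi\sqrt2}+\frac{6}{\pi\sqrt2\,\log p}+\frac{1}{\log p},\qquad D=\left(\frac{x}{c\sqrt p\,\log p}\right)^{1/2},\qquad \hat D=\frac{D}{D-1},\qquad A=0.679091,$$ and suppose $D>1$. Define $$E = (\log p)^{1/2}\Biggl(\frac{6}{\pi^2}\Bigl(c^{1/2}+\hat D c^{1/2}-p^{-1/4}(\log p)^{-1/2}\Bigr) + A\Bigl(p^{1/8-\alpha/4}c^{3/4}(\log p)^{1/4}-\tfrac13 p^{-1/4-\alpha/4}(\log p)^{1/2}+\tfrac73 p^{1/8-\alpha/4}(\log p)^{1/4}c^{3/4}\Bigr)\Biggr)$$ and $$G_s(x) = x^{1/2}p^{-1/4}-\frac{\pi^2}{6}\left(\frac{0.104}{p^{1/4}}+\left(2^{\omega(k)}\Delta+1\right)E\right).$$ If $G_s(x)>0$, then $p$ has a square-free primitive root less than $x$.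
   Context: For a positive integer $m$ with distinct prime divisors $p_1,\dots,p_r$, $\mathrm{Rad}(m)=p_1\cdots p_r$. A primitive root modulo the prime $p$ is an integer coprime to $p$ of multiplicative order $p-1$ modulo $p$. A positive integer is square-free if it is not divisible by the square of any prime. $\log$ is the natural logarithm. *)

(* Defs.v *)
(* MathComp and MathComp-Analysis: naturals are ssrnat, reals are an arbitrary
   R : realType. *)
From mathcomp Require Import all_boot all_order all_algebra.
From mathcomp Require Import reals exp trigo.

Set Implicit Arguments.
Unset Strict Implicit.
Unset Printing Implicit Defensive.

Import Order.TTheory GRing.Theory Num.Theory.
Local Open Scope ring_scope.

Definition omega (m : nat) : nat := size (primes m).

Definition radn (m : nat) : nat := (\prod_(q <- primes m) q)%N.

(* [primes m] is sorted increasingly. *)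
Definition prod_smallest_primes (n m : nat) : nat :=
  (\prod_(q <- take n (primes m)) q)%N.

Definition squarefree (n : nat) : Prop :=
  (0 < n)%N /\ forall q : nat, prime q -> ~~ (q ^ 2 %| n)%N.

(* For p prime.  In 'F_p, [d.-primitive_root z] says that d is the least
   positive integer with z ^+ d = 1, i.e. that z has multiplicative order d. *)
Definition primitive_root_mod (p g : nat) : Prop :=
  coprime g p /\ (p.-1).-primitive_root (g%:R : 'F_p).

Section Constants.
Variable R : realType.

(* 0.679091, split because a literal 679091 would be unfolded in unary. *)
Definition const_A : R := 679 / 10 ^+ 3 + 91 / 10 ^+ 6.

Definition sieve_delta (s : nat) (q : 'I_s -> nat) : R :=
  1 - \sum_(i < s) (q i)%:R^-1.

Definition sieve_Delta (s : nat) (q : 'I_s -> nat) : R :=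
  (s%:R - 1) / sieve_delta q + 2.

Variables (p : nat) (alpha : R).
Local Notation P := (p%:R : R).
Local Notation L := (ln p%:R : R).

Definition xpow : R := P `^ alpha.

Definition const_c : R :=
  1 / (pi * Num.sqrt 2) + 6 / (pi * Num.sqrt 2 * L) + 1 / L.

Definition const_D : R := (xpow / (const_c * Num.sqrt P * L)) `^ (1 / 2).

Definition const_Dhat : R := const_D / (const_D - 1).

Definition const_E : R :=
  let c := const_c in
  L `^ (1 / 2) *
  (6 / pi ^+ 2 *
     (c `^ (1 / 2) + const_Dhat * c `^ (1 / 2)
      - P `^ (- (1 / 4)) * L `^ (- (1 / 2)))
   + const_A *
     (P `^ (1 / 8 - alpha / 4) * c `^ (3 / 4) * L `^ (1 / 4)
      - 1 / 3 * P `^ (- (1 / 4) - alpha / 4) * L `^ (1 / 2)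
      + 7 / 3 * P `^ (1 / 8 - alpha / 4) * L `^ (1 / 4) * c `^ (3 / 4))).

Definition const_G (s : nat) (q : 'I_s -> nat) (k : nat) : R :=
  xpow `^ (1 / 2) * P `^ (- (1 / 4))
  - pi ^+ 2 / 6 *
    (104 / 10 ^+ 3 / P `^ (1 / 4)
     + (2 ^+ omega k * sieve_Delta q + 1) * const_E).

End Constants.

(* Main.v *)
Require Import Defs.
From mathcomp Require Import all_boot all_order all_algebra.
From mathcomp Require Import cyclic ring lra zify complex.
From mathcomp Require Import reals exp trigo.
From mathcomp Require classical_sets topology normedtype derive.

Import Order.TTheory GRing.Theory Num.Theory.
Local Open Scope ring_scope.

(** Let T be the sum of min(B, x/d^2) over the squarefree d with d^2 < x,
   where B = c p^(1/2) log p bounds every incomplete sum of a nonprincipal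
   character.  Detecting squares by inclusion-exclusion bounds each character
   sum over the squarefree n < x by T.

   The bound B is proved as by Frolenkov and Soundararajan: averaging the
   interval over 2h shifts, with 2h about p^(1/2), turns the completed sum
   into a sum of products of two Dirichlet kernels, and the inequality
   |sin t| <= (1 - cos(2t)/2) / sqrt 2 gives the constant 1/(pi sqrt 2).

   The constant pi^2/6 is not evaluated as zeta(2).  Write kappa for the
   product of 1 - q^(-2) over the primes q <= p.  Both T and the number of
   squarefree n < x are kappa times the corresponding unrestricted sum, with
   explicit errors, so the factor kappa cancels and kappa >= 0.59 suffices.

   Finally an integer n < x is a primitive root exactly when no prime factor
   of p - 1 divides its discrete logarithm.  The sieve with core k and
   sieving primes q_i gives a squarefree one as soon as the number of
   squarefree n < x exceeds (2^omega(k) Delta - 1) T. *)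

(** The constants c and D satisfy x = D^2 B, so D is the place where min(B, x/d^2) changes branch
    and T is about 2 kappa D B. Put W = 2^omega(k) Delta. After multiplication by x^(1/2) p^(1/4),
    the hypothesis G > 0 implies (W + 1) Y < x with Y = 2 D B + B - D B^(1/2) + 3.2 D^(1/2) B,
    whereas the sieve asks only for (W - 1) T < N, where N counts the squarefree n < x. The gap
    between W + 1 and W - 1 makes crude error terms affordable: T is at most kappa Y + (2 - kappa)
    B, N is at least kappa (x - 1) - 2 x^(1/2), and the spare 2 kappa Y pays for the losses on both
    sides. The cancellation requires literally the same kappa in T and in N. Hence both come from
    one estimate for an arbitrary decreasing weight, whose error is again a sum of terms min(1,
    G^2/e^2) over squarefree e, with a free parameter G of the order of the square root of the total
    mass. *)

Local Notation "x %:C" := (real_complex _ x) : ring_scope.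
Local Notation "R [i]" := (complex R) : type_scope.

(** * Trigonometric inequalities *)

Section MeanValue.
Import classical_sets topology normedtype derive numFieldNormedType.Exports.

Lemma sin_mvt {R : realType} (x y : R) : x < y ->
  exists2 z, x < z < y & sin y - sin x = cos z * (y - x).
Proof.
move=> xy.
have h : {within `[x, y], continuous (@sin R)}%classic.
  by apply: continuous_subspaceT => t; exact: continuous_sin.
have [z zxy ->] := MVT xy (fun t _ => is_derive_sin t) h.
by exists z.
Qed.

End MeanValue.

Section Trigonometry.
Context {R : realType}.
Implicit Types (x y t : R).

Lemma sin_le_id y : 0 <= y -> sin y <= y.
Proof.
rewrite le_eqVlt => /predU1P[<-|y0]; first by rewrite sin0.
have [z _] := sin_mvt 0 y y0; rewrite sin0 !subr0 => ->.
by apply: ler_piMl; [exact: ltW | exact: cos_le1].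
Qed.

Lemma abs_sin_le y : `|sin y| <= `|y|.
Proof.
have [y0|y0] := leP 0 y.
  have h1 := sin_le_id y y0; rewrite (ger0_norm y0) ler_norml h1 andbT.
  have [ylt|ylt] := leP y 1; last by rewrite (le_trans _ (sin_geN1 y))// lerN2 ltW.
  rewrite (le_trans _ (sin_ge0_pi _)) ?oppr_le0// y0 /=.
  by rewrite (le_trans ylt)// (le_trans _ (pi_ge2 R))// ler1n.
have ny : 0 <= - y by rewrite oppr_ge0 ltW.
rewrite -normrN -sinN -(normrN y) (ger0_norm ny).
have h1 := sin_le_id (- y) ny; rewrite ler_norml h1 andbT.
have [ylt|ylt] := leP (- y) 1; last by rewrite (le_trans _ (sin_geN1 _))// lerN2 ltW.
rewrite (le_trans _ (sin_ge0_pi _)) ?oppr_le0// ny /=.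
by rewrite (le_trans ylt)// (le_trans _ (pi_ge2 R))// ler1n.
Qed.

Lemma cos_ge_quad y : 1 - y ^+ 2 / 2 <= cos y.
Proof.
have -> : cos y = 1 - 2 * sin (y / 2) ^+ 2.
  have -> : cos y = cos ((y / 2) *+ 2) by congr (cos _); field.
  rewrite cos_mulr2n cos2sin2; ring.
have := abs_sin_le (y / 2).
rewrite -ler_sqr ?nnegrE// !real_normK ?num_real// => h.
by rewrite expr_div_n in h; lra.
Qed.

Lemma sin_ge_cubic y : 0 <= y <= 1 -> y * (1 - y ^+ 2 / 2) <= sin y.
Proof.
move=> /andP[]; rewrite le_eqVlt => /predU1P[<-|y0] y1; first by rewrite sin0 mul0r.
have [z /andP[z0 zy]] := sin_mvt 0 y y0; rewrite sin0 !subr0 => ->.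
rewrite mulrC ler_pM2r// (le_trans _ (cos_ge_quad z))//.
have := ler_pM (ltW z0) (ltW z0) (ltW zy) (ltW zy); rewrite -!expr2; lra.
Qed.

Lemma inv_sin_le y : 0 < y <= 1 -> (sin y)^-1 <= y^-1 + y.
Proof.
move=> /andP[y0 y1].
have h := sin_ge_cubic y; rewrite (ltW y0) y1 in h; have {}h := h isT.
have y2 : y ^+ 2 <= 1 by rewrite expr_le1// ltW.
have s0 : 0 < sin y.
  by apply: lt_le_trans h; apply: mulr_gt0 => //; lra.
rewrite -[leLHS]mul1r ler_pdivrMr//.
have -> : y^-1 + y = (1 + y ^+ 2) / y by field; rewrite gt_eqF.
rewrite mulrAC ler_pdivlMr// mul1r.
(* It remains that (1 + y^2)(1 - y^2/2) >= 1, which holds because y <= 1. *)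
apply: (@le_trans _ _ ((1 + y ^+ 2) * (y * (1 - y ^+ 2 / 2)))); last first.
  by apply: ler_wpM2l => //; rewrite addr_ge0// sqr_ge0.
rewrite mulrCA ler_peMr ?(ltW y0)//.
have := sqr_ge0 y; nra.
Qed.

(** Concavity of sine through two mean values: the slope on [0, y] is at least the slope on
    [y, pi/2], because cosine decreases. *)
Lemma jordan_sin y : 0 <= y <= pi / 2 -> y <= pi / 2 * sin y.
Proof.
have pi0 := pi_gt0 R.
move=> /andP[]; rewrite le_eqVlt => /predU1P[<-|y0]; first by rewrite sin0 mulr0.
rewrite le_eqVlt => /predU1P[->|y1]; first by rewrite sin_pihalf mulr1.
have [u /andP[u0 uy]] := sin_mvt 0 y y0; rewrite sin0 !subr0 => eu.
have [v /andP[v0 vy]] := sin_mvt y (pi / 2) y1; rewrite sin_pihalf => ev.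
have cuv : cos v <= cos u.
  by apply/ltW; rewrite ltr_cos ?in_itv/=; lra.
have := ler_wpM2r (ltW y0) cuv; rewrite -eu.
have := ler_wpM2r (_ : 0 <= pi / 2 - y) cuv; rewrite -ev => h1 h2.
have {}h1 := h1 ltac:(lra).
have a1 : y * (1 - sin y) <= y * (cos u * (pi / 2 - y)) by rewrite ler_wpM2l// ltW.
have a2 : y * (cos u * (pi / 2 - y)) = sin y * (pi / 2 - y) by rewrite eu; ring.
by rewrite a2 in a1; lra.
Qed.

(** The triple angle formula at t = pi/6 gives (sin t + 1)(2 sin t - 1)^2 = 0, so sin t = 1/2, and
    sin t <= t concludes. *)
Lemma pi_ge3 : 3 <= pi :> R.
Proof.
have pi0 := pi_gt0 R.
set t : R := pi / 6.
have e3 : sin (t *+ 2 + t) = 1.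
  by rewrite -sin_pihalf; congr sin; rewrite /t; field.
rewrite sinD sin_mulr2n cos_mulr2n in e3.
have h := cos2Dsin2 t.
have t0 : 0 < t by rewrite divr_gt0.
have s0 : 0 <= sin t by rewrite sin_ge0_pi// (ltW t0)/= /t; lra.
have e : (sin t + 1) * (2 * sin t - 1) ^+ 2 = 0.
  have -> : (sin t + 1) * (2 * sin t - 1) ^+ 2 = 4 * sin t ^+ 3 - 3 * sin t + 1 by ring.
  rewrite -{3}e3; move: h; set c := cos t; set s := sin t => h.
  have -> : c ^+ 2 = 1 - s ^+ 2 by lra.
  have -> : (c * s) *+ 2 * c = 2 * s * c ^+ 2 by ring.
  have -> : c ^+ 2 = 1 - s ^+ 2 by lra.
  ring.
have : sin t = 2^-1.
  move/eqP: e; rewrite mulf_eq0 sqrf_eq0 => /orP[/eqP|/eqP]; lra.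
have := sin_le_id t (ltW t0); rewrite /t; lra.
Qed.

Lemma pi_le4 : pi <= 4 :> R.
Proof. by have := pihalf_lt2 R; lra. Qed.

Lemma inv_pi_sqrt2_ge : 6^-1 <= (pi * Num.sqrt 2)^-1 :> R.
Proof.
have s20 : 0 < Num.sqrt 2 :> R by rewrite sqrtr_gt0.
have s22 : Num.sqrt 2 <= 3 / 2 :> R.
  have -> : 3 / 2 = Num.sqrt ((3 / 2) ^+ 2) :> R by rewrite sqrtr_sqr ger0_norm// divr_ge0.
  by rewrite ler_sqrt ?exprn_ge0//; lra.
have pi0 := pi_gt0 R; have pi4 := pi_le4.
rewrite lef_pV2 ?posrE ?mulr_gt0//.
by have := ler_pM (ltW pi0) (ltW s20) pi4 s22; move: (_ * _) => u; lra.
Qed.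

(** With a = |sin y| the right side is (1/2 + a^2)/sqrt 2, so the claim is (sqrt 2 a - 1)^2 >= 0. *)
Lemma abs_sin_le_cos y : `|sin y| <= (1 - cos (y *+ 2) / 2) / Num.sqrt 2.
Proof.
rewrite cos_mulr2n cos2sin2.
set s : R := Num.sqrt 2; have s2 : s ^+ 2 = 2 by rewrite sqr_sqrtr.
have s0 : 0 < s by rewrite sqrtr_gt0.
rewrite ler_pdivlMr//.
have := sqr_ge0 (s * `|sin y| - 1).
rewrite sqrrB1 exprMn s2 real_normK ?num_real//.
set a : R := `|sin y|; set b : R := sin y ^+ 2 => h.
have -> : (1 - b) *+ 2 = 2 - 2 * b by ring.
by rewrite -mulr_natr in h; lra.
Qed.

End Trigonometry.

(** * Cosine and harmonic sums *)

Section RealSums.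
Context {R : realType}.
Implicit Types (x y t : R).

(** Summation by parts against the decreasing weights 1/a. *)
Lemma abel_tail (s : nat -> R) (A n : nat) :
  (forall a, -1 <= s a <= 1) ->
  - (2 / A.+1%:R) <= \sum_(A.+1 <= a < A.+1 + n) (s a - s a.-1) / a%:R.
Proof.
move=> hs.
(* The induction keeps the boundary term. Using s + 1, which is nonnegative, lets its weight be
   lowered from 1/a to 1/(a + 1) at each step. *)
suff h : (s (A + n)%N + 1) / (A + n).+1%:R - 2 / A.+1%:R
      <= \sum_(A.+1 <= a < A.+1 + n) (s a - s a.-1) / a%:R.
  apply: le_trans h; rewrite lerDr divr_ge0//.
  by have := hs (A + n)%N; lra.
elim: n => [|n IH].
  rewrite !addn0 big_geq// -mulrBl mulr_le0_ge0 ?invr_ge0//.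
  by have := hs A; lra.
rewrite addSn in IH; rewrite addSn !addnS big_nat_recr ?ltnS ?leq_addr// -pred_Sn.
apply: le_trans (lerD IH (lexx _)).
move: (hs (A + n).+1) => h1.
have h2 : (s (A + n).+1 + 1) / (A + n).+2%:R <= (s (A + n).+1 + 1) / (A + n).+1%:R.
  rewrite ler_wpM2l//; first lra.
  by rewrite lef_pV2 ?posrE// ler_nat.
rewrite mulrBl; rewrite [X in _ <= X - _ + _]mulrDl.
by move: h2; move: ((A + n).+1%:R^-1) ((A + n).+2%:R^-1) (A.+1%:R^-1) (s _) (s _) => u v w a b; lra.
Qed.

Lemma two_sin_half_cos t (a : nat) : (0 < a)%N ->
  2 * sin (t / 2) * cos (a%:R * t) =
  sin ((a%:R + 2^-1) * t) - sin ((a.-1%:R + 2^-1) * t).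
Proof.
move=> a0.
have -> : a.-1%:R = a%:R - 1 :> R by rewrite -subn1 natrB.
have -> : (a%:R + 2^-1) * t = a%:R * t + t / 2 by field.
have -> : (a%:R - 1 + 2^-1) * t = a%:R * t - t / 2 by field.
by rewrite sinD sinB; ring.
Qed.

(* Up to a <= pi / (2 t) the terms are nonnegative; the rest telescopes. *)
Lemma sum_cos_div_ge t (K : nat) : 0 < t <= pi ->
  - 2 <= \sum_(1 <= a < K.+1) cos (a%:R * t) / a%:R.
Proof.
move=> /andP[t0 tpi]; have pi0 := pi_gt0 R.
set A := Num.truncn (pi / (2 * t)).
have pt0 : 0 <= pi / (2 * t) by rewrite divr_ge0 ?mulr_ge0 ?ltW.
have /andP[A1 A2] := truncn_itv pt0.
rewrite -/A in A1 A2.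
have head n : (n <= A)%N -> 0 <= \sum_(1 <= a < n.+1) cos (a%:R * t) / a%:R.
  move=> nA; rewrite big_nat_cond sumr_ge0// => a /andP[/andP[a1 an] _].
  rewrite divr_ge0// cos_ge0_pihalf//.
  have : a%:R * t <= pi / 2.
    have aA : (a%:R : R) <= pi / (2 * t).
      by apply: le_trans A1; rewrite ler_nat; lia.
    have -> : pi / 2 = pi / (2 * t) * t by field; rewrite gt_eqF.
    by rewrite ler_wpM2r// ltW.
  have : 0 <= a%:R * t by rewrite mulr_ge0// ltW.
  lra.
have [KA|KA] := leqP K A; first by have := head K KA; lra.
rewrite (@big_cat_nat _ _ _ A.+1)//=; last by rewrite ltnS ltnW.
have := head A (leqnn _); set X := \sum_(1 <= a < A.+1) _ => X0.
have s0 : 0 < sin (t / 2) by rewrite sin_gt0_pi//; lra.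
have e : \sum_(A.+1 <= a < K.+1) cos (a%:R * t) / a%:R =
   (2 * sin (t / 2))^-1 * \sum_(A.+1 <= a < A.+1 + (K - A))
     (sin ((a%:R + 2^-1) * t) - sin ((a.-1%:R + 2^-1) * t)) / a%:R.
  rewrite addSn subnKC ?(ltnW KA)// big_distrr /=.
  apply: eq_big_nat => a /andP[a1 _].
  rewrite -two_sin_half_cos ?(leq_trans _ a1)//.
  have a0 : (0 : R) < a%:R by rewrite ltr0n; lia.
  by field; rewrite !gt_eqF.
have h := @abel_tail (fun a => sin ((a%:R + 2^-1) * t)) A (K - A).
have {}h := h (fun a => ltac:(by rewrite sin_geN1 sin_le1)).
rewrite e.
have j := jordan_sin (t / 2); have {}j := j ltac:(lra).
(* Since A + 1 > pi/(2t), Jordan's inequality gives (A + 1) sin(t/2) >= 1/2; this turns the tail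
   bound 1/((A + 1) sin(t/2)) into the constant 2. *)
have k : 1 <= 2 * (A.+1%:R * sin (t / 2)).
  have h1 : pi / (2 * t) * sin (t / 2) <= A.+1%:R * sin (t / 2).
    by rewrite ler_wpM2r// ltW.
  have h2 : 2^-1 <= pi / (2 * t) * sin (t / 2).
    have e2 : 2^-1 = (t / 2) / t by field; rewrite gt_eqF.
    have -> : pi / (2 * t) * sin (t / 2) = pi / 2 * sin (t / 2) / t.
      by field; rewrite gt_eqF.
    by rewrite [leLHS]e2 ler_wpM2r// invr_ge0 ltW.
  lra.
have A0 : (0 : R) < A.+1%:R by rewrite ltr0n.
have h3 : - 2 <= (2 * sin (t / 2))^-1 * - (2 / A.+1%:R).
  have -> : (2 * sin (t / 2))^-1 * - (2 / A.+1%:R) = - (A.+1%:R * sin (t / 2))^-1.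
    by move: A0 s0; move: (A.+1%:R) (sin _) => u v u0 v0; field; rewrite !gt_eqF.
  rewrite lerN2 -[leLHS]mul1r ler_pdivrMr//.
  by rewrite mulr_gt0.
have : (2 * sin (t / 2))^-1 * - (2 / A.+1%:R) <=
   (2 * sin (t / 2))^-1 * \sum_(A.+1 <= a < A.+1 + (K - A))
     (sin ((a%:R + 2^-1) * t) - sin ((a.-1%:R + 2^-1) * t)) / a%:R.
  by rewrite ler_wpM2l// invr_ge0 mulr_ge0// ltW.
by move=> h4; apply: le_trans h3 _; apply: le_trans h4 _; rewrite lerDr.
Qed.

Lemma harmonic_le (K : nat) : (0 < K)%N ->
  \sum_(1 <= a < K.+1) (a%:R : R)^-1 <= 1 + ln K%:R.
Proof.
case: K => // K _; elim: K => [|K IH]; first by rewrite big_nat1 ln1 invr1 addr0.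
rewrite big_nat_recr//=.
have h : (K.+2%:R : R)^-1 <= ln K.+2%:R - ln K.+1%:R.
  rewrite -lerN2 opprB -ln_div ?posrE//.
  have -> : (K.+1%:R / K.+2%:R : R) = 1 + - K.+2%:R^-1.
    rewrite -[K.+2%:R]natr1; have : (0 : R) < K.+1%:R by rewrite ltr0n.
    by move: (K.+1%:R) => u u0; field; rewrite gt_eqF//; lra.
  by apply: le_ln1Dx; rewrite ltrN2 invf_lt1// ltr1n.
apply: le_trans (lerD IH (lexx _)) _.
by move: h; move: (K.+2%:R^-1) (ln _) (ln _) => u v w; lra.
Qed.

Lemma sum_inv_sqr_le (K n : nat) : (0 < K)%N ->
  \sum_(K.+1 <= a < n) (a%:R ^+ 2 : R)^-1 <= K%:R^-1.
Proof.
move=> K0.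
have [nK|Kn] := leqP n K.+1; first by rewrite big_geq// invr_ge0.
suff h m : \sum_(K.+1 <= a < K.+1 + m) (a%:R ^+ 2 : R)^-1 <= K%:R^-1 - (K + m)%:R^-1.
  rewrite -(subnKC (ltnW Kn)); apply: le_trans (h _) _.
  by rewrite gerBl invr_ge0.
elim: m => [|m IH]; first by rewrite !addn0 big_geq// subrr.
rewrite addnS big_nat_recr ?leq_addr//=.
apply: le_trans (lerD IH (lexx _)) _.
rewrite addSn addnS -addrA lerD2l.
have m0 : (0 : R) < (K + m)%:R by rewrite ltr0n addn_gt0 K0.
rewrite -natr1; move: m0; move: ((K + m)%:R) => u m0.
have -> : - u^-1 + ((u + 1) ^+ 2)^-1 = - (u + 1)^-1 - (u * (u + 1) ^+ 2)^-1.
  by field; rewrite !gt_eqF//; lra.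
by rewrite gerBl invr_ge0 mulr_ge0 ?ltW// exprn_gt0//; lra.
Qed.

Lemma abs_sin_natmul_le (n : nat) y : `|sin (n%:R * y)| <= n%:R * `|sin y|.
Proof.
elim: n => [|n IH]; first by rewrite !mul0r sin0 normr0.
rewrite -[n.+1]addn1 natrD !mulrDl !mul1r sinD.
apply: le_trans (ler_normD _ _) _; rewrite !normrM.
apply: lerD.
  by apply: le_trans IH; rewrite ler_piMr// cos_max.
by rewrite ler_piMl// cos_max.
Qed.

End RealSums.

(** * The Dirichlet kernels *)

Section Kernel.
Context {R : realType}.
Variables (p N : nat).
Hypotheses (p_gt100 : (100 < p)%N) (N_gt0 : (0 < N)%N) (N_lt : (N < p)%N).

Local Notation P := (p%:R : R).
Local Notation r := (Num.sqrt p%:R : R).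
Local Notation L := (ln p%:R : R).

Lemma P_gt0 : 0 < P. Proof. by rewrite ltr0n; lia. Qed.
Local Hint Resolve P_gt0 : core.

Lemma r_sqr : r ^+ 2 = P. Proof. by rewrite sqr_sqrtr ?ltW ?P_gt0. Qed.

Lemma r_ge10 : 10 <= r.
Proof.
have -> : 10 = Num.sqrt (10 ^+ 2) :> R by rewrite sqrtr_sqr ger0_norm.
by rewrite ler_sqrt// -natrX ler_nat; lia.
Qed.

(** The cosines depend on [N] only up to sign modulo [p], so [N] may be replaced by [p - N]; the
    smaller of the two gives an angle at most pi. *)
Lemma sum_cos_double_ge (K : nat) :
  - 2 <= \sum_(1 <= a < K.+1) cos ((pi * a%:R * N%:R / P) *+ 2) / a%:R.
Proof.
have pi0 := pi_gt0 R.
have [h|h] := leqP (N.*2) p.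
  have := @sum_cos_div_ge R (2 * pi * N%:R / P) K _.
  have -> : 0 < 2 * pi * N%:R / P <= pi.
    apply/andP; split; first by rewrite divr_gt0// !mulr_gt0// ltr0n.
    rewrite ler_pdivrMr// -mulrA mulrCA ler_pM2l//.
    by rewrite -natrM ler_nat mul2n.
  move=> /(_ isT); congr (_ <= _); apply: eq_bigr => a _.
  by congr (cos _ / _); ring.
have := @sum_cos_div_ge R (2 * pi * (p - N)%:R / P) K _.
have -> : 0 < 2 * pi * (p - N)%:R / P <= pi.
  apply/andP; split; first by rewrite divr_gt0// !mulr_gt0// ltr0n subn_gt0.
  rewrite ler_pdivrMr// -mulrA mulrCA ler_pM2l//.
  by rewrite -natrM ler_nat; lia.
move=> /(_ isT); congr (_ <= _); apply: eq_bigr => a _.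
congr (_ / _); rewrite -[RHS]cosN natrB ?(ltnW N_lt)//.
have -> : a%:R * (2 * pi * (P - N%:R) / P)
    = - (pi * a%:R * N%:R / P *+ 2) + pi *+ 2 *+ a.
  have -> : pi *+ 2 *+ a = a%:R * (2 * pi) :> R by rewrite -mulr_natl; ring.
  by field; rewrite gt_eqF.
by rewrite periodicn//; exact: cosD2pi.
Qed.

(** The lower bound -2 for the cosine sum adds only 1 to the 1 + ln K of the harmonic sum. *)
Lemma sum_abs_sin_div_le (K : nat) : (0 < K)%N ->
  \sum_(1 <= a < K.+1) `|sin (pi * a%:R * N%:R / P)| / a%:R
    <= (2 + ln K%:R) / Num.sqrt 2.
Proof.
move=> K0; set s2 : R := Num.sqrt 2.
have s20 : 0 < s2 by rewrite sqrtr_gt0.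
apply: (@le_trans _ _ (\sum_(1 <= a < K.+1)
   ((1 - cos ((pi * a%:R * N%:R / P) *+ 2) / 2) / s2) / a%:R)).
  apply: ler_sum => a _; rewrite ler_wpM2r ?invr_ge0//.
  exact: abs_sin_le_cos.
have -> : \sum_(1 <= a < K.+1)
   ((1 - cos ((pi * a%:R * N%:R / P) *+ 2) / 2) / s2) / a%:R
  = (\sum_(1 <= a < K.+1) (a%:R : R)^-1 - (\sum_(1 <= a < K.+1)
     cos ((pi * a%:R * N%:R / P) *+ 2) / a%:R) / 2) / s2.
  rewrite mulr_suml -sumrB mulr_suml; apply: eq_bigr => a _.
  by move: (cos _) (a%:R^-1) (s2^-1) => u v w; field.
rewrite ler_pM2r ?invr_gt0//.
have := harmonic_le (R := R) K K0; have := sum_cos_double_ge K.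
by move: (\sum_(_ <= _ < _) _) (\sum_(_ <= _ < _) _) (ln _) => u v w; lra.
Qed.

(* 2 h is the smoothing length, and K the frequency up to which the kernel of
   length 2 h is bounded trivially. *)
Lemma smoothing_parameters : exists K h : nat,
  [/\ (0 < K <= p./2)%N, (0 < h)%N, r <= K%:R <= r + 1,
      r <= (h.*2)%:R & h%:R <= r / 2 + 1].
Proof.
pose K := (Num.truncn r).+1; pose h := uphalf K.
have r0 : 0 <= r by rewrite sqrtr_ge0.
have /andP[r1 r2] := truncn_itv r0.
have K1 : K%:R <= r + 1 :> R by rewrite /K -natr1 lerD2r.
have hK : (K <= h.*2 <= K.+1)%N by rewrite /h; have := odd_double_half K; rewrite uphalf_half; case: odd; lia.
exists K, h; split => //.
- rewrite /= -(ler_nat R).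
  apply: le_trans K1 _.
  have : P <= (p./2.*2.+1)%:R :> R by rewrite ler_nat; have := odd_double_half p; case: odd; lia.
  rewrite -natr1 -muln2 natrM -{1}r_sqr.
  by move: (p./2%:R) r_ge10; move: (r) => u v; nra.
- by rewrite K1 ltW.
- by apply: (le_trans (ltW r2)); rewrite ler_nat; lia.
- have : h.*2%:R <= K.+1%:R :> R by rewrite ler_nat; lia.
  rewrite -natr1 -muln2 natrM; move: K1; move: (K%:R) (h%:R) (r) => a b c; lra.
Qed.

(* The product |D_N(a) D_H(a)| of Dirichlet kernels modulo p, with H = 2 h. *)
Definition dirichlet_prod (h a : nat) : R :=
  `|sin (pi * a%:R * N%:R / P)| * `|sin (pi * a%:R * (h.*2)%:R / P)|
   / sin (pi * a%:R / P) ^+ 2.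

(** The term [h] is the cost of averaging over shifts; the other term is the completed double sum
    divided by 2 h. Up to [K] the kernel of length 2 h is at most 2 h, and 1/sin y <= 1/y + y;
    beyond [K] the numerators are at most 1 and Jordan's inequality bounds the denominator. The main
    term is as small as it is because ln K is about half of log p. *)
Lemma dirichlet_prod_bound : exists h : nat, (0 < h)%N /\
  h%:R + 2 / (r * (h.*2)%:R) * \sum_(1 <= a < p./2.+1) dirichlet_prod h a
    <= r * ((L + 6) / (pi * Num.sqrt 2) + 1).
Proof.
have pi0 := pi_gt0 R; have pi4 := pi_le4 (R := R).
have [K [h [/andP[K0 Kp] h0 /andP[rK Kr] rh hr]]] := smoothing_parameters.
exists h; split => //.
have rg := r_ge10; have P0 := P_gt0.
have r0 : 0 < r by lra.
pose H : R := (h.*2)%:R; have H0 : 0 < H by rewrite ltr0n double_gt0.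
have K0' : (0 : R) < K%:R by rewrite ltr0n.
have y_itv a : (1 <= a < p./2.+1)%N -> 0 < pi * a%:R / P <= pi / 2.
  move=> /andP[a1 a2]; rewrite divr_gt0 ?mulr_gt0// ?ltr0n//=.
  rewrite -mulrA ler_pM2l// ler_pdivrMr// mulrC ler_pdivlMr//.
  rewrite -natrM ler_nat; move: a2; clear; have := odd_double_half p; case: odd; lia.
have s_gt0 a : (1 <= a < p./2.+1)%N -> 0 < sin (pi * a%:R / P).
  by move=> /y_itv ya; rewrite sin_gt0_pi//; lra.
have small a : (1 <= a < K.+1)%N -> dirichlet_prod h a <=
   H * (P / pi * (`|sin (pi * a%:R * N%:R / P)| / a%:R) + pi / P * a%:R).
  move=> aK; have a' : (1 <= a < p./2.+1)%N by move: aK Kp K0; clear; lia.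
  have s0 := s_gt0 a a'; have /andP[y0 _] := y_itv a a'.
  have a0 : (0 : R) < a%:R by rewrite ltr0n; case/andP: a'.
  have h1 : `|sin (pi * a%:R * (h.*2)%:R / P)| <= H * sin (pi * a%:R / P).
    have := abs_sin_natmul_le (R := R) h.*2 (pi * a%:R / P).
    by rewrite (gtr0_norm s0); congr (`|sin _| <= _); ring.
  have y1 : pi * a%:R / P <= 1.
    rewrite ler_pdivrMr// mul1r -r_sqr.
    have : a%:R <= r + 1 by apply: le_trans Kr; rewrite ler_nat; case/andP: aK.
    move=> ar; apply: (@le_trans _ _ (4 * (r + 1))).
      by apply: ler_pM => //; apply: ltW.
    by move: (r) rg => v; nra.
  have h2 := inv_sin_le (pi * a%:R / P); rewrite y0 y1 in h2; have {}h2 := h2 isT.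
  rewrite /dirichlet_prod; move: h1 h2 s0 y0; set y := pi * a%:R / P.
  set sN : R := `|sin (pi * _ * N%:R / _)|; set sH : R := `|sin _|; set s := sin y => h1 h2 s0 y0.
  have sN0 : 0 <= sN <= 1 by rewrite normr_ge0 sin_max.
  apply: (@le_trans _ _ (H * (sN / s))).
    have -> : H * (sN / s) = sN * (H * s) / s ^+ 2 by field; rewrite gt_eqF.
    by rewrite ler_pM2r ?invr_gt0 ?exprn_gt0// ler_wpM2l//; case/andP: sN0.
  rewrite ler_pM2l//.
  have -> : P / pi * (sN / a%:R) = sN * y^-1 by rewrite /y !invfM invrK; ring.
  have -> : pi / P * a%:R = y by rewrite /y; ring.
  apply: (@le_trans _ _ (sN * (y^-1 + y))); first by rewrite ler_wpM2l//; case/andP: sN0.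
  by rewrite mulrDr lerD2l; apply: ler_piMl; [exact: ltW | case/andP: sN0].
have large a : (K.+1 <= a < p./2.+1)%N -> dirichlet_prod h a <= P ^+ 2 / 4 * (a%:R ^+ 2)^-1.
  move=> aK; have a' : (1 <= a < p./2.+1)%N by move: aK Kp K0; clear; lia.
  have s0 := s_gt0 a a'; have /andP[y0 y1] := y_itv a a'.
  have a0 : (0 : R) < a%:R by rewrite ltr0n; case/andP: a'.
  have j := jordan_sin (pi * a%:R / P); rewrite (ltW y0) y1 in j; have {}j := j isT.
  have j2 : 2 * a%:R / P <= sin (pi * a%:R / P).
    have : pi / 2 * (2 * a%:R / P) <= pi / 2 * sin (pi * a%:R / P).
      by apply: le_trans j; rewrite le_eqVlt; apply/orP; left; apply/eqP; field; rewrite gt_eqF.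
    by rewrite ler_pM2l// divr_gt0.
  rewrite /dirichlet_prod; set s := sin (pi * _ / _) in j2 s0 *.
  have t0 : 0 < 2 * a%:R / P by rewrite divr_gt0 ?mulr_gt0.
  have -> : P ^+ 2 / 4 * (a%:R ^+ 2)^-1 = ((2 * a%:R / P) ^+ 2)^-1.
    by field; rewrite !gt_eqF.
  apply: (@le_trans _ _ ((s ^+ 2)^-1)).
    rewrite ler_piMl ?invr_ge0 ?exprn_ge0 ?(ltW s0)//.
    by rewrite mulr_ile1 ?sin_max.
  by rewrite lef_pV2 ?posrE ?exprn_gt0// lerXn2r// nnegrE ltW.
have S_le : \sum_(1 <= a < p./2.+1) dirichlet_prod h a <=
   H * (P / pi * ((2 + ln K%:R) / Num.sqrt 2) + pi / P * (K%:R * (K%:R + 1) / 2))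
   + P ^+ 2 / 4 * K%:R^-1.
  rewrite (@big_cat_nat _ _ _ K.+1)//=.
  apply: lerD.
    apply: (@le_trans _ _ (\sum_(1 <= a < K.+1)
      H * (P / pi * (`|sin (pi * a%:R * N%:R / P)| / a%:R) + pi / P * a%:R))).
      rewrite big_nat_cond [leRHS]big_nat_cond; apply: ler_sum => a; rewrite andbT; exact: small.
    rewrite -mulr_sumr ler_pM2l// big_split /= -!mulr_sumr lerD//.
      by rewrite ler_pM2l ?divr_gt0//; exact: sum_abs_sin_div_le.
    rewrite ler_pM2l ?divr_gt0//.
    have -> : \sum_(1 <= a < K.+1) (a%:R : R) = K%:R * (K%:R + 1) / 2; last by [].
    elim: (K) => [|k IH]; first by rewrite big_geq// !mul0r.
    by rewrite big_nat_recr//= IH -natr1; field.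
  apply: (@le_trans _ _ (\sum_(K.+1 <= a < p./2.+1) P ^+ 2 / 4 * (a%:R ^+ 2)^-1)).
    rewrite big_nat_cond [leRHS]big_nat_cond; apply: ler_sum => a; rewrite andbT; exact: large.
  rewrite -mulr_sumr ler_pM2l ?divr_gt0 ?exprn_gt0//.
  exact: sum_inv_sqr_le.
have lnK : ln K%:R <= L / 2 + r^-1.
  apply: (@le_trans _ _ (ln (r * (1 + r^-1)))).
    rewrite ler_ln ?posrE// ?mulr_gt0 ?addr_gt0 ?invr_gt0// mulrDr mulr1 mulfV ?gt_eqF//.
  rewrite lnM ?posrE ?addr_gt0 ?invr_gt0//; apply: lerD; last first.
    by apply: le_ln1Dx; rewrite (lt_le_trans (ltrN10 R))// invr_ge0 ltW.
  have e : ln r *+ 2 = L by rewrite -lnXn// r_sqr.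
  by rewrite -e; move: (ln r) => u; lra.
have s20 : 0 < Num.sqrt 2 :> R by rewrite sqrtr_gt0.
have c0 := inv_pi_sqrt2_ge (R := R).
have -> : r * ((L + 6) / (pi * Num.sqrt 2) + 1) =
   r * (pi * Num.sqrt 2)^-1 * (L + 6) + r by ring.
apply: (@le_trans _ _ (h%:R + 2 / (r * H) *
   (H * (P / pi * ((2 + ln K%:R) / Num.sqrt 2) + pi / P * (K%:R * (K%:R + 1) / 2))
   + P ^+ 2 / 4 * K%:R^-1))).
  by rewrite lerD2l ler_pM2l// divr_gt0// mulr_gt0.
have -> : 2 / (r * H) *
   (H * (P / pi * ((2 + ln K%:R) / Num.sqrt 2) + pi / P * (K%:R * (K%:R + 1) / 2))
   + P ^+ 2 / 4 * K%:R^-1) =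
   r * (pi * Num.sqrt 2)^-1 * (4 + 2 * ln K%:R) + pi * (K%:R * (K%:R + 1)) / r ^+ 3
   + r / 2 * ((r / H) * (r / K%:R)).
  have := conj r_sqr (conj s20 (conj pi0 (conj K0' (conj H0 r0)))).
  clearbody H; clear; move: P (K%:R) (ln _) pi (Num.sqrt 2) (r).
  by move=> P c f b a e [<- [a0 [b0 [c0 [H0 e0]]]]]; field; rewrite !gt_eqF.
(* The tail and [h] contribute r/2 each, which makes up the summand 1 of the bound. The leftovers 1
   and 6/10 fit into r/6 because r >= 10, and r/6 is paid for by passing from L + 5 to L + 6. *)
have b1 : r / 2 * ((r / H) * (r / K%:R)) <= r / 2.
  rewrite ler_piMr ?divr_ge0 ?(ltW r0)//.
  by rewrite mulr_ile1 ?divr_ge0 ?(ltW r0) ?(ltW H0) ?(ltW K0')// ler_pdivrMr// mul1r.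
have b2 : pi * (K%:R * (K%:R + 1)) / r ^+ 3 <= 6 / 10.
  rewrite ler_pdivrMr ?exprn_gt0//.
  apply: (@le_trans _ _ (4 * ((r + 1) * (r + 1 + 1)))).
    apply: ler_pM => //; rewrite ?(ltW pi0) ?mulr_ge0 ?addr_ge0 ?(ltW K0')//.
    by apply: ler_pM; rewrite ?addr_ge0 ?(ltW K0') ?lerD2r.
  have r3 : r ^+ 3 = r * r ^+ 2 by ring.
  by rewrite r3; move: (r) rg => v vg; nra.
have b3 : r * (pi * Num.sqrt 2)^-1 * (4 + 2 * ln K%:R)
     <= r * (pi * Num.sqrt 2)^-1 * (L + 5).
  rewrite ler_pM2l ?mulr_gt0 ?invr_gt0 ?mulr_gt0//.
  have : r^-1 <= 10^-1 by rewrite lef_pV2 ?posrE.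
  by move: lnK; move: (ln _) (ln _) (r^-1) => u v w; lra.
have b4 : r / 6 <= r * (pi * Num.sqrt 2)^-1 by rewrite ler_pM2l.
have -> : r * (pi * Num.sqrt 2)^-1 * (L + 6) = r * (pi * Num.sqrt 2)^-1 * (L + 5) + r * (pi * Num.sqrt 2)^-1 by ring.
by clear -b1 b2 b3 b4 hr rg; lra.
Qed.

End Kernel.

(** * The Polya-Vinogradov inequality *)

Section ComplexExponential.
Context {R : realType}.
Local Notation C := R[i].
Implicit Types (x y t : R).

Definition cexp t : C := Complex (cos t) (sin t).

Lemma cexpD x y : cexp (x + y) = cexp x * cexp y.
Proof.
apply/eqP; rewrite eq_complex /= cosD sinD eqxx /=.
by apply/eqP; ring.
Qed.

Lemma cexp0 : cexp 0 = 1.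
Proof. by rewrite /cexp cos0 sin0. Qed.

Lemma cexpMn t n : cexp (t *+ n) = cexp t ^+ n.
Proof. by elim: n => [|n IH]; rewrite ?mulr0n ?cexp0// mulrS exprS cexpD IH. Qed.

Lemma norm_cexp t : `|cexp t| = 1.
Proof. by rewrite normc_def /= cos2Dsin2 sqrtr1. Qed.

Lemma cexp_2pi n : cexp ((2 * pi) *+ n) = 1.
Proof.
rewrite cexpMn; suff -> : cexp (2 * pi) = 1 by rewrite expr1n.
by rewrite /cexp mulr_natl cos2pi sin2pi.
Qed.

Lemma norm_cexp_sub1 t : `|cexp t - 1| = (2 * `|sin (t / 2)|)%:C.
Proof.
rewrite normc_def /= subr0; congr (_%:C).
have -> : (cos t - 1) ^+ 2 + sin t ^+ 2 = (2 * sin (t / 2)) ^+ 2.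
  have e : t = (t / 2) *+ 2 by field.
  rewrite [in cos t]e [in sin t]e cos_mulr2n sin_mulr2n.
  have h := cos2Dsin2 (t / 2).
  move: h; set c := cos _; set s := sin _ => h.
  have hs : s ^+ 2 = 1 - c ^+ 2 by rewrite -h; ring.
  have -> : (c * s *+ 2) ^+ 2 = 4 * c ^+ 2 * s ^+ 2 by ring.
  have -> : (2 * s) ^+ 2 = 4 * s ^+ 2 by ring.
  by rewrite hs; ring.
by rewrite sqrtr_sqr normrM ger0_norm.
Qed.

Lemma norm_sum_geom t (n : nat) : sin (t / 2) != 0 ->
  `|\sum_(i < n) cexp t ^+ i| = (`|sin (n%:R * t / 2)| / `|sin (t / 2)|)%:C.
Proof.
move=> st.
have h : (cexp t - 1) * \sum_(i < n) cexp t ^+ i = cexp (t *+ n) - 1 by rewrite cexpMn subrX1.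
have := congr1 (fun z => `|z|) h; rewrite normrM !norm_cexp_sub1.
have s0 : 0 < 2 * `|sin (t / 2)| by rewrite mulr_gt0 ?normr_gt0.
have s0' : (2 * `|sin (t / 2)|)%:C != 0 :> C by rewrite (fmorph_eq0 (real_complex R)) gt_eqF.
move=> e; apply: (mulfI s0'); rewrite e -(rmorphM (real_complex R)); congr (_%:C).
by rewrite -(mulr_natl t n) -[RHS]mulrA; congr (_ * _); rewrite mulrCA mulfV ?normr_eq0// mulr1.
Qed.

End ComplexExponential.

(** * Roots of unity *)

Section RootsOfUnity.
Context {R : realType}.
Local Notation C := R[i].
Variable m : nat.
Hypothesis m_gt0 : (0 < m)%N.

Definition zeta : C := cexp (2 * pi / m%:R).

Lemma zetaX n : zeta ^+ n = cexp (2 * pi * n%:R / m%:R).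
Proof. by rewrite /zeta -cexpMn; congr (cexp _); rewrite -mulr_natr; ring. Qed.

Lemma norm_zetaX n : `|zeta ^+ n| = 1.
Proof. by rewrite zetaX norm_cexp. Qed.

Lemma zeta_order : zeta ^+ m = 1.
Proof.
by rewrite zetaX mulfK ?pnatr_eq0 -?lt0n// -[2 * pi]mulr1n cexp_2pi.
Qed.

Lemma zetaX_mod n : zeta ^+ (n %% m) = zeta ^+ n.
Proof. by rewrite {2}(divn_eq n m) mulnC exprD exprM zeta_order expr1n mul1r. Qed.

Lemma sin_pi_frac_gt0 (a : nat) : (0 < a < m)%N -> 0 < sin (pi * a%:R / m%:R : R).
Proof.
move=> /andP[a0 am]; have pi0 := pi_gt0 R.
have m0 : (0 : R) < m%:R by rewrite ltr0n.
rewrite sin_gt0_pi// divr_gt0 ?mulr_gt0 ?ltr0n//=.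
by rewrite ltr_pdivrMr// ltr_pM2l// ltr_nat.
Qed.

Lemma zetaX_eq1 (n : nat) : (zeta ^+ n == 1) = (m %| n)%N.
Proof.
rewrite -zetaX_mod /dvdn; case: (posnP (n %% m)) => [->|n0]; first by rewrite expr0 eqxx.
apply/negbTE.
rewrite -subr_eq0 -normr_eq0 zetaX norm_cexp_sub1.
have := sin_pi_frac_gt0 (n %% m); rewrite n0 ltn_pmod// => /(_ isT).
have -> : 2 * pi * (n %% m)%:R / m%:R / 2 = pi * (n %% m)%:R / m%:R :> R.
  by field; rewrite pnatr_eq0 -lt0n.
by move=> s0; rewrite (fmorph_eq0 (real_complex R)) mulf_neq0 ?normr_eq0 ?gt_eqF.
Qed.

End RootsOfUnity.

(** * Gauss sums and completion of character sums *)

Section PolyaVinogradov.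
Context {R : realType}.
Local Notation C := R[i].
Variable p : nat.
Hypotheses (p_prime : prime p) (p_gt100 : (100 < p)%N).

Lemma p_gt0 : (0 < p)%N. Proof. exact: prime_gt0. Qed.
Local Hint Resolve p_gt0 : core.

Definition addchar (a : 'F_p) : C := zeta p ^+ (a : nat).

Lemma addchar_nat n : addchar n%:R = zeta p ^+ n.
Proof. by rewrite /addchar val_Fp_nat// zetaX_mod. Qed.

Lemma addcharD a b : addchar (a + b) = addchar a * addchar b.
Proof.
by rewrite -[a]natr_Zp -[b]natr_Zp -natrD !addchar_nat exprD.
Qed.

Lemma addchar0 : addchar 0 = 1.
Proof. by rewrite /addchar. Qed.

Lemma norm_addchar a : `|addchar a| = 1.
Proof. exact: norm_zetaX. Qed.

Lemma conj_addchar a : (addchar a)^* = addchar (- a).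
Proof.
have h : addchar a * addchar (- a) = 1 by rewrite -addcharD subrr addchar0.
have n0 : addchar a != 0 by rewrite -normr_eq0 norm_addchar oner_eq0.
by apply: (mulfI n0); rewrite h -normCK norm_addchar expr1n.
Qed.

Lemma addchar_eq1 a : (addchar a == 1) = (a == 0).
Proof.
rewrite /addchar zetaX_eq1//; apply/idP/eqP => [pa|->]; last exact: dvdn0.
apply/val_inj; case: (posnP a) => // a0; move: (dvdn_leq a0 pa).
by have := ltn_ord a; rewrite [X in (_ < X)%N -> _](Fp_cast p_prime) ltnNge => /negPf ->.
Qed.

Lemma sum_addchar b : \sum_(a : 'F_p) addchar (a * b) = if b == 0 then p%:R else 0.
Proof.
case: eqP => [->|/eqP b0].
  under eq_bigr do rewrite mulr0 addchar0.
  by rewrite sumr_const card_Fp.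
have h : addchar b * \sum_(a : 'F_p) addchar (a * b) = \sum_(a : 'F_p) addchar (a * b).
  rewrite [RHS](reindex_inj (addIr 1)) /= mulr_sumr; apply: eq_bigr => a _.
  by rewrite mulrDl mul1r addcharD mulrC.
apply/eqP; have := addchar_eq1 b; rewrite (negPf b0) => /negbT b1.
have : (addchar b - 1) * \sum_(a : 'F_p) addchar (a * b) == 0.
  by rewrite mulrBl h mul1r subrr.
by rewrite mulf_eq0 subr_eq0 (negPf b1).
Qed.

Section Character.
Variable chi : 'F_p -> C.
Hypothesis chiM : forall a b, chi (a * b) = chi a * chi b.
Hypothesis norm_chi : forall a, a != 0 -> `|chi a| = 1.
Hypothesis chi0 : chi 0 = 0.
Hypothesis sum_chi : \sum_a chi a = 0.

Definition gauss (a : 'F_p) : C := \sum_x chi x * addchar (a * x).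

Lemma norm_gauss a : a != 0 -> `|gauss a| = `|gauss 1|.
Proof.
move=> a0.
have h : chi a * gauss a = gauss 1.
  rewrite /gauss [RHS](reindex_inj (mulfI a0)) /= mulr_sumr.
  by apply: eq_bigr => x _; rewrite chiM mul1r mulrA.
by rewrite -h normrM norm_chi// mul1r.
Qed.

Lemma gauss_inversion b : p%:R * chi b = \sum_a gauss a * addchar (- (a * b)).
Proof.
under eq_bigr do rewrite mulr_suml.
rewrite exchange_big /=.
have e x : \sum_a chi x * addchar (a * x) * addchar (- (a * b)) =
    chi x * if x - b == 0 then p%:R else 0.
  rewrite -sum_addchar mulr_sumr; apply: eq_bigr => a _.
  by rewrite -mulrA -addcharD mulrBr.
under eq_bigr do rewrite e.
rewrite (bigD1 b)//= subrr eqxx big1 ?addr0 1?mulrC// => x xb.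
by rewrite subr_eq0 (negPf xb) mulr0.
Qed.

Lemma card_nz : #|[pred x : 'F_p | x != 0]| = p.-1.
Proof.
have <- : #|predC1 (0 : 'F_p)| = p.-1 by rewrite cardC1 card_Fp.
by apply: eq_card => x; rewrite !inE.
Qed.

(** Parseval: the squared moduli of all [gauss a] add up to p (p - 1), the value at 0 vanishes, and
    the other p - 1 moduli are equal. *)
Lemma norm_gauss_sqr : `|gauss 1| ^+ 2 = p%:R.
Proof.
have h : \sum_a `|gauss a| ^+ 2 = p%:R * (p.-1)%:R :> C.
  have e a : `|gauss a| ^+ 2 = \sum_x (chi x)^* * (gauss a * addchar (- (a * x))).
    rewrite normCK {2}/gauss rmorph_sum /= mulr_sumr; apply: eq_bigr => x _.
    by rewrite mulrCA; congr (_ * _); rewrite rmorphM; congr (_ * _); exact: conj_addchar.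
  under eq_bigr do rewrite e.
  rewrite exchange_big /=.
  under eq_bigr do rewrite -mulr_sumr -gauss_inversion mulrCA [(chi _)^* * _]mulrC -normCK.
  rewrite -mulr_sumr; congr (_ * _).
  rewrite (bigD1 0)//= chi0 normr0 expr0n /= add0r.
  under eq_bigr => x x0 do rewrite norm_chi// expr1n.
  rewrite sumr_const; congr (_%:R).
  exact: card_nz.
have g0 : gauss 0 = 0.
  by rewrite /gauss -[RHS]sum_chi; apply: eq_bigr => x _; rewrite mul0r addchar0 mulr1.
move: h; rewrite (bigD1 0)//= g0 normr0 expr0n /= add0r.
under eq_bigr => a a0 do rewrite norm_gauss//.
rewrite sumr_const; set m := #|_|; have -> : m = p.-1 by exact: card_nz.
rewrite -[_ *+ p.-1]mulr_natr => /mulIf; apply.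
by rewrite pnatr_eq0; have := p_gt100; case: (p) => [|[]].
Qed.

Lemma gauss0 : gauss 0 = 0.
Proof. by rewrite /gauss -[RHS]sum_chi; apply: eq_bigr => x _; rewrite mul0r addchar0 mulr1. Qed.

Lemma norm_gauss_le a : `|gauss a| <= (Num.sqrt p%:R : R)%:C.
Proof.
have [->|a0] := eqVneq a 0; first by rewrite gauss0 normr0 lecR sqrtr_ge0.
rewrite norm_gauss// le_eqVlt; apply/orP; left.
rewrite -(@eqrXn2 _ 2)//; last by rewrite lecR sqrtr_ge0.
by rewrite norm_gauss_sqr -rmorphXn/= sqr_sqrtr// rmorph_nat.
Qed.

Lemma addcharMn a n : addchar (a *+ n) = addchar a ^+ n.
Proof. by elim: n => [|n IH]; rewrite ?addchar0// mulrS exprS addcharD IH. Qed.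

Lemma norm_sum_addcharX (a : 'F_p) (n : nat) : a != 0 ->
  `|\sum_(i < n) addchar a ^+ i|
  = (`|sin (pi * (a : nat)%:R * n%:R / p%:R)| / sin (pi * (a : nat)%:R / p%:R) : R)%:C.
Proof.
move=> a0.
have ap : (0 < (a : nat) < p)%N.
  apply/andP; split; first by rewrite lt0n; apply: contra a0 => /eqP e; apply/eqP/val_inj.
  by have := ltn_ord a; rewrite [X in (_ < X)%N](Fp_cast p_prime).
have s0 := sin_pi_frac_gt0 (R := R) p p_gt0 _ ap.
have e : 2 * pi * (a : nat)%:R / p%:R / 2 = pi * (a : nat)%:R / p%:R :> R.
  by field; rewrite pnatr_eq0 -lt0n.
rewrite /addchar zetaX norm_sum_geom e ?gt_eqF// (gtr0_norm s0).
by congr ((`|sin _| / _)%:C); field; rewrite pnatr_eq0 -lt0n.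
Qed.

Lemma sum_Fp_nz (F : nat -> R) :
  \sum_(a : 'F_p | a != 0) F (a : nat) = \sum_(1 <= a < p) F a.
Proof.
have h : \sum_(0 <= a < p) F a = \sum_(a : 'F_p) F (a : nat).
  by rewrite -[in LHS](Fp_cast p_prime) big_mkord.
rewrite (bigD1 (0 : 'F_p))//= in h.
move: h; rewrite big_ltn//= => h.
by apply: (addrI (F 0%N)); rewrite h.
Qed.

(** Gauss inversion separates the variables [i] and [j], so each frequency [a] contributes a product
    of two geometric sums, that is of two Dirichlet kernels. The shift [s] enters through a factor
    of modulus 1, and a = 0 drops out since [gauss 0] is 0. *)
Lemma norm_double_sum (N h s : nat) :
  `|\sum_(i < N) \sum_(j < h.*2) chi (i + j + s)%:R|
   <= ((Num.sqrt p%:R)^-1 * \sum_(1 <= a < p) dirichlet_prod p N h a : R)%:C.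
Proof.
have P0 : (0 : R) < p%:R by rewrite ltr0n.
have r0 : 0 < Num.sqrt p%:R :> R by rewrite sqrtr_gt0.
have P0' : 0 < p%:R :> C by rewrite ltr0n.
rewrite -(ler_pM2l P0') -[X in X * `|_| ](gtr0_norm P0') -normrM.
have -> : p%:R * \sum_(i < N) \sum_(j < h.*2) chi (i + j + s)%:R =
   \sum_(a : 'F_p) gauss a * addchar (- a) ^+ s *
     ((\sum_(i < N) addchar (- a) ^+ i) * (\sum_(j < h.*2) addchar (- a) ^+ j)).
  rewrite mulr_sumr; under eq_bigr => i _ do rewrite mulr_sumr.
  under eq_bigr => i _ do under eq_bigr => j _ do rewrite gauss_inversion//.
  under eq_bigr => i _ do rewrite exchange_big /=.
  rewrite exchange_big /=; apply: eq_bigr => a _.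
  rewrite big_distrlr /= mulr_sumr; apply: eq_bigr => i _.
  rewrite mulr_sumr; apply: eq_bigr => j _.
  rewrite -mulrA; congr (_ * _).
  by rewrite mulr_natr -mulNrn addcharMn addnC !exprD.
apply: (@le_trans _ _ (\sum_(a : 'F_p | a != 0) (Num.sqrt p%:R : R)%:C *
   (dirichlet_prod p N h (a : nat) : R)%:C)).
  rewrite (bigD1 0)//= gauss0 !mul0r add0r.
  apply: le_trans (ler_norm_sum _ _ _) _.
  rewrite [leRHS](reindex_inj oppr_inj) /=.
  under [leRHS]eq_bigl do rewrite oppr_eq0.
  apply: ler_sum => a a0.
  rewrite !normrM normrX norm_addchar expr1n mulr1.
  apply: ler_pM; rewrite ?mulr_ge0 ?norm_gauss_le//.
  rewrite !norm_sum_addcharX ?oppr_eq0// -rmorphM lecR /dirichlet_prod.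
  by rewrite le_eqVlt mulrACA -expr2 exprVn eqxx.
rewrite -mulr_sumr -rmorph_sum sum_Fp_nz -!rmorphM /= -(rmorph_nat (real_complex R)) -rmorphM lecR.
rewrite mulrA le_eqVlt; apply/orP; left; apply/eqP; congr (_ * _).
by rewrite -[X in X / _](@sqr_sqrtr _ p%:R) ?ltW// expr2 mulfK ?gt_eqF.
Qed.

Lemma dirichlet_prod_sym (N h a : nat) : (a <= p)%N ->
  dirichlet_prod p N h (p - a) = dirichlet_prod p N h a :> R.
Proof.
move=> ap.
have P0 : p%:R != 0 :> R by rewrite pnatr_eq0 -lt0n.
have e (n : nat) : `|sin (pi * (p - a)%:R * n%:R / p%:R)| = `|sin (pi * a%:R * n%:R / p%:R)| :> R.
  have -> : pi * (p - a)%:R * n%:R / p%:R = - (pi * a%:R * n%:R / p%:R) + pi *+ n :> R.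
    by rewrite natrB// -[pi *+ n]mulr_natr; field.
  rewrite (alternatingn (@sinDpi R)) normrM normrX normrN1 expr1n mul1r.
  by rewrite sinN normrN.
have e1 := e 1%N; rewrite !mulr1 in e1.
rewrite /dirichlet_prod !e -!(real_normK (num_real (sin _))).
by rewrite e1.
Qed.

Lemma sum_dirichlet_prod (N h : nat) :
  \sum_(1 <= a < p) dirichlet_prod p N h a
  = 2 * \sum_(1 <= a < p./2.+1) dirichlet_prod p N h a :> R.
Proof.
have podd : odd p by case: (even_prime p_prime) => // e2; move: p_gt100; rewrite e2.
have e := odd_double_half p; rewrite podd in e.
rewrite (@big_cat_nat _ _ _ p./2.+1)//=; last by lia.
rewrite mulr_natl mulr2n; congr (_ + _).
rewrite -[p./2.+1]add1n big_addn.
have -> : (p - p./2 = p./2.+1)%N by lia.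
rewrite big_nat_rev /= add1n; apply: eq_big_nat => a /andP[a1 a2].
have -> : (p./2.+2 - a.+1 + p./2 = p - a)%N by lia.
by rewrite dirichlet_prod_sym//; lia.
Qed.

Lemma chi_period b n : chi (b + n * p)%:R = chi b%:R.
Proof.
congr chi; rewrite natrD natrM.
have -> : p%:R = 0 :> 'F_p; last by rewrite mulr0 addr0.
by apply/val_inj; rewrite /= val_Fp_nat// modnn.
Qed.

Lemma norm_chi_le1 a : `|chi a| <= 1.
Proof.
by have [->|a0] := eqVneq a 0; rewrite ?chi0 ?normr0// norm_chi.
Qed.

(** A shift by one removes one end term and adds another, at a cost of at most 2. *)
Lemma norm_shift_sub (N s k : nat) :
  `|\sum_(i < N) chi (i + s)%:R - \sum_(i < N) chi (i + (s + k))%:R| <= (2 * k)%:R.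
Proof.
elim: k => [|k IH]; first by rewrite addn0 subrr normr0.
have -> : \sum_(i < N) chi (i + s)%:R - \sum_(i < N) chi (i + (s + k.+1))%:R =
  (\sum_(i < N) chi (i + s)%:R - \sum_(i < N) chi (i + (s + k))%:R) +
  (\sum_(i < N) chi (i + (s + k))%:R - \sum_(i < N) chi (i + (s + k.+1))%:R).
  by rewrite addrA subrK.
apply: le_trans (ler_normD _ _) _; rewrite mulnS (addnC 2%N) natrD lerD//.
set u := (s + k)%N; rewrite addnS.
have -> : \sum_(i < N) chi (i + u)%:R - \sum_(i < N) chi (i + u.+1)%:R
  = chi u%:R - chi (N + u)%:R.
  elim: (N) => [|m IHm]; first by rewrite !big_ord0 !subrr.
  by rewrite !big_ord_recr /= addnS opprD addrACA IHm addrA subrK.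
by apply: le_trans (ler_normB _ _) _; rewrite (natrD _ 1 1) lerD ?norm_chi_le1.
Qed.

(** In truncated subtraction [(j - h) + (h - j)] is |j - h|, and twice this bounds the change of the
    sum under a shift from [j] to [h]. *)
Lemma sum_distance (h : nat) : (\sum_(j < h.*2) (2 * ((j - h) + (h - j))) = 2 * h ^ 2)%N.
Proof.
rewrite -addnn big_split_ord /=.
have -> : (\sum_(i < h) 2 * (i - h + (h - i)) = \sum_(i < h) 2 * (h - i))%N.
  by apply: eq_bigr => i _; have := ltn_ord i; lia.
have -> : (\sum_(i < h) 2 * (h + i - h + (h - (h + i))) = \sum_(i < h) 2 * i)%N.
  by apply: eq_bigr => i _; lia.
rewrite -big_split /= (eq_bigr (fun _ => 2 * h)%N); last first.
  by move=> i _; have := ltn_ord i; lia.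
by rewrite sum_nat_const card_ord; lia.
Qed.

Theorem polya_vinogradov (N : nat) : (N < p)%N ->
  `|\sum_(1 <= i < N.+1) chi i%:R|
  <= (Num.sqrt p%:R * ((ln p%:R + 6) / (pi * Num.sqrt 2) + 1) : R)%:C.
Proof.
move=> Np.
have P0 : (0 : R) < p%:R by rewrite ltr0n.
have r0 : 0 < Num.sqrt p%:R :> R by rewrite sqrtr_gt0.
case: (posnP N) => [->|N0].
  rewrite big_geq// normr0 lecR mulr_ge0 ?ltW// addr_gt0// divr_gt0//.
    by rewrite ltr_wpDl// ln_ge0// ler1n.
  by rewrite mulr_gt0 ?pi_gt0 ?sqrtr_gt0.
have [h [h0 hb]] := @dirichlet_prod_bound R p N p_gt100 N0 Np.
(* Modulo [p] this is 1 - h, kept natural: h + s = 1 + h p, so the middle shift j = h returns the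
   original interval. Centring it halves the average distance to the other shifts. *)
set s := (1 + h * p.-1)%N.
set T := fun j : nat => \sum_(i < N) chi (i + (j + s))%:R.
have -> : \sum_(1 <= i < N.+1) chi i%:R = T h.
  rewrite big_add1 /= big_mkord; apply: eq_bigr => i _.
  rewrite -(chi_period _ h); congr (chi _%:R).
  by rewrite /s -{1}(prednK p_gt0) mulnS; lia.
have dT j : `|T h - T j| <= (2 * ((j - h) + (h - j)))%:R.
  case: (leqP h j) => hj.
    have := norm_shift_sub N (h + s) (j - h).
    by rewrite /T addnAC subnKC// (eqP hj) addn0.
  have := norm_shift_sub N (j + s) (h - j).
  by rewrite /T addnAC subnKC 1?ltnW// distrC (eqP (ltnW hj)) add0n.
have H0 : 0 < (h.*2)%:R :> C by rewrite ltr0n double_gt0.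
have key : (h.*2)%:R * `|T h| <= (2 * h ^ 2)%:R + `|\sum_(j < h.*2) T j|.
  rewrite -[X in X * `|_| ](gtr0_norm H0) -normrM.
  have -> : (h.*2)%:R * T h = \sum_(j < h.*2) (T h - T j) + \sum_(j < h.*2) T j.
    by rewrite -big_split /= (eq_bigr (fun=> T h)) ?sumr_const ?card_ord ?mulr_natl// => j _; rewrite subrK.
  apply: le_trans (ler_normD _ _) _; rewrite lerD2r.
  apply: le_trans (ler_norm_sum _ _ _) _.
  by rewrite -sum_distance natr_sum; apply: ler_sum => j _; exact: dT.
have key2 : `|\sum_(j < h.*2) T j| <= ((Num.sqrt p%:R)^-1 * \sum_(1 <= a < p) dirichlet_prod p N h a : R)%:C.
  rewrite exchange_big /=.
  have := norm_double_sum N h s; congr (`|_| <= _).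
  by apply: eq_bigr => i _; apply: eq_bigr => j _; rewrite addnA.
rewrite -(ler_pM2l H0); apply: le_trans key _.
apply: le_trans (lerD (lexx _) key2) _.
rewrite -!(rmorph_nat (real_complex R)) -rmorphD -rmorphM lecR.
have H0' : 0 < (h.*2)%:R :> R by rewrite ltr0n double_gt0.
rewrite -(ler_pM2l H0') in hb; apply: le_trans hb.
rewrite sum_dirichlet_prod le_eqVlt; apply/orP; left; apply/eqP.
move: H0'; rewrite -muln2 expnS expn1 !natrM; set S := \sum_(_ <= _ < _) _.
move: r0; move: (Num.sqrt _) (h%:R) S => u v w u0 v0.
have {}v0 : 0 < v by lra.
by field; rewrite !gt_eqF.
Qed.

End Character.
End PolyaVinogradov.

(** * Sums over squarefree integers *)

(** A decidable form of [squarefree] for use as a summation filter. It holds vacuously at 0, so all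
    sums start at 1. *)
Definition sqf (n : nat) : bool := [forall i : 'I_n.+1, prime i ==> ~~ (i ^ 2 %| n)%N].

Lemma sqfP (n : nat) : (0 < n)%N ->
  reflect (forall q, prime q -> ~~ (q ^ 2 %| n)%N) (sqf n).
Proof.
move=> n0; apply: (iffP forallP) => [h q qp|h i]; last by apply/implyP; exact: h.
apply/negP => qn; have qlt : (q < n.+1)%N.
  rewrite ltnS; apply: leq_trans (dvdn_leq n0 qn).
  by rewrite -{1}(expn1 q) leq_exp2l// prime_gt1.
by have := h (Ordinal qlt); rewrite /= qp qn.
Qed.

(** * Inclusion-exclusion over finite sets of primes *)

Section PrimeSets.
Variable M : nat.
Implicit Types (J : {set 'I_M.+1}).

Definition prime_set J : bool := [forall i in J, prime i].

Definition set_prod J : nat := (\prod_(i in J) i)%N.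

Lemma dvdn_set_prod J (i : 'I_M.+1) : i \in J -> (i %| set_prod J)%N.
Proof. by move=> iJ; rewrite /set_prod (bigD1 i)//= dvdn_mulr. Qed.

Lemma set_prod_gt0 J : prime_set J -> (0 < set_prod J)%N.
Proof.
move=> /forall_inP hJ; rewrite prodn_cond_gt0// => i /hJ; exact: prime_gt0.
Qed.

Lemma mem_prime_set J (i : 'I_M.+1) : prime_set J -> prime i ->
  (i %| set_prod J)%N = (i \in J).
Proof.
move=> /forall_inP hJ ip; apply/idP/idP; last exact: dvdn_set_prod.
rewrite /set_prod Euclid_dvd_prod// big_orE => /exists_inP[j jJ ij].
by move: ij; rewrite (dvdn_prime2 ip (hJ j jJ)) => /eqP/val_inj ->.
Qed.

Lemma set_prod_inj : {in prime_set &, injective set_prod}.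
Proof.
move=> J K hJ hK e; apply/setP => i.
have [ip|ip] := boolP (prime i).
  by rewrite -(mem_prime_set J i hJ ip) -(mem_prime_set K i hK ip) e.
have no L : prime_set L -> i \notin L.
  by move=> /forall_inP hL; apply: contra ip; exact: hL.
by rewrite (negPf (no _ hJ)) (negPf (no _ hK)).
Qed.

Lemma sqf_set_prod J : prime_set J -> sqf (set_prod J).
Proof.
move=> hJ; apply/sqfP; first exact: set_prod_gt0.
move=> q qp; apply/negP => q2.
have : (q %| set_prod J)%N by apply: dvdn_trans q2; rewrite dvdn_exp.
rewrite {1}/set_prod Euclid_dvd_prod// big_orE => /exists_inP[j jJ qj].
have jp : prime j by move/forall_inP: hJ; exact.
have ej : q = j by apply/eqP; rewrite -dvdn_prime2.
move: q2; rewrite ej /set_prod (bigD1 j)//= expnS expn1 dvdn_pmul2l ?prime_gt0//.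
rewrite Euclid_dvd_prod// big_orE => /exists_inP[l /andP[lJ lj]].
have lp : prime l by move/forall_inP: hJ; exact.
by rewrite dvdn_prime2// => /eqP/val_inj e; rewrite e eqxx in lj.
Qed.

Lemma dvdn_sqr_set_prod J n : prime_set J ->
  (set_prod J ^ 2 %| n)%N = [forall i in J, i ^ 2 %| n]%N.
Proof.
move=> /forall_inP hJ.
have -> : [forall i in J, i ^ 2 %| n]%N = all (fun i : 'I_M.+1 => (i ^ 2 %| n)%N) (enum J).
  by apply/forall_inP/allP => h i; have := h i; rewrite mem_enum.
have -> : set_prod J = (\prod_(i <- enum J) i)%N by rewrite /set_prod big_enum.
have : all (fun i : 'I_M.+1 => prime i) (enum J) by apply/allP => i; rewrite mem_enum; exact: hJ.
elim: (enum J) (enum_uniq J) => [|i s IH]; first by rewrite big_nil exp1n dvd1n.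
rewrite /= => /andP[iS us] /andP[ip ps]; rewrite big_cons expnMn Gauss_dvd ?IH//.
rewrite coprimeXl// coprimeXr// prime_coprime//.
apply/negP; rewrite Euclid_dvd_prod// big_has => /hasP[j jS].
rewrite dvdn_prime2//; last by move/allP: ps; exact.
by move=> /eqP/val_inj e; rewrite e jS in iS.
Qed.

Lemma prod_if_set (A : comNzRingType) (f : 'I_M.+1 -> A) J :
  \prod_i (if i \in J then f i else 1) = \prod_(i in J) f i.
Proof. by rewrite [RHS]big_mkcond. Qed.

Lemma prod_set_sign (A : comNzRingType) (P : pred 'I_M.+1) (c : 'I_M.+1 -> A) J :
  \prod_(i in J) (if P i then - c i else 0) =
  if [forall i in J, P i] then (-1) ^+ #|J| * \prod_(i in J) c i else 0.
Proof.
case: ifPn => [/forall_inP h|/forall_inPn[i iJ nP]].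
  rewrite -prodrN; by apply: eq_bigr => i /h ->.
by rewrite (bigD1 i)//= (negPf nP) mul0r.
Qed.

(* Inclusion-exclusion over the primes up to M: set_prod J plays the role of e
   in the identity mu^2(n) = sum of mu(e) over e^2 | n. *)
Lemma sqf_sum_prime_sets (A : comNzRingType) (n : nat) : (0 < n <= M)%N ->
  (sqf n)%:R = \sum_(J | prime_set J && (set_prod J ^ 2 %| n)%N) (-1) ^+ #|J| :> A.
Proof.
move=> /andP[n0 nM].
(* The product of the factors 1 + F i is 1 for squarefree [n] and 0 otherwise; expanding it by
   distributivity gives the sum over sets. *)
pose F (i : 'I_M.+1) : A := if prime i && (i ^ 2 %| n)%N then -1 else 0.
have -> : (sqf n)%:R = \prod_i (F i + 1).
  have [/(sqfP _ n0) h|] := boolP (sqf n).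
    rewrite big1// => i _; rewrite /F.
    by case: (boolP (prime i)) => [/h /negPf ->|_] /=; rewrite add0r.
  move=> /forallPn[ i]; rewrite negb_imply negbK => /andP[ip i2].
  have iM : (i < M.+1)%N by rewrite (leq_trans (ltn_ord i)).
  by rewrite (bigD1 (Ordinal iM))//= /F /= ip i2 addNr mul0r.
rewrite bigA_distr /= [RHS]big_mkcond; apply: eq_big => [J|J _]; first by rewrite inE.
rewrite prod_if_set (prod_set_sign A (fun i : 'I_M.+1 => prime i && (i ^ 2 %| n)%N) (fun=> 1)).
rewrite big1// mulr1; congr (if _ then _ else _).
have [hJ|hJ] := boolP (prime_set J); last first.
  apply/negbTE; apply: contra hJ => /forall_inP h; apply/forall_inP => i /h /andP[]//.
rewrite /= dvdn_sqr_set_prod//; apply/forall_inP/forall_inP => h i iJ; have := h i iJ; first by case/andP.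
by move=> ->; rewrite andbT; move/forall_inP: hJ; exact.
Qed.

Lemma sum_sqf_prime_sets (A : comNzRingType) (N : nat) (f : nat -> A) : (N <= M)%N ->
  \sum_(1 <= n < N.+1 | sqf n) f n =
  \sum_(J | prime_set J) (-1) ^+ #|J| *
     \sum_(1 <= n < N.+1 | (set_prod J ^ 2 %| n)%N) f n.
Proof.
move=> NM; rewrite big_mkcond.
under [RHS]eq_bigr => J _ do rewrite mulr_sumr big_mkcond /=.
rewrite exchange_big /=; apply: eq_big_nat => n /andP[n1 nN].
rewrite -big_mkcondr /= -mulr_suml -sqf_sum_prime_sets; last by rewrite n1 (leq_trans _ NM).
by case: (sqf n); rewrite ?mul1r ?mul0r.
Qed.

Variable R : realFieldType.

(** A truncation of 1/zeta(2) by primes, not by size: mu(e)/e^2 is summed over all products e of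
    distinct primes up to [M], however large, so that the sum is exactly a finite Euler product. *)
Definition kappa : R := \sum_(J | prime_set J) (-1) ^+ #|J| / (set_prod J)%:R ^+ 2.

Lemma kappaE : kappa = \prod_(0 <= i < M.+1) (1 - (prime i)%:R / i%:R ^+ 2).
Proof.
rewrite big_mkord.
have -> : \prod_(i < M.+1) (1 - (prime i)%:R / i%:R ^+ 2 : R) =
  \prod_(i < M.+1) ((if prime i then - (i%:R ^- 2) else 0) + 1).
  by apply: eq_bigr => i _; case: prime; rewrite ?mul1r ?mul0r ?subr0 ?add0r// addrC.
rewrite bigA_distr /= [LHS]big_mkcond; apply: eq_big => [J|J _]; first by rewrite inE.
rewrite prod_if_set (prod_set_sign _ (fun i : 'I_M.+1 => prime i) (fun i : 'I_M.+1 => i%:R ^- 2)).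
rewrite -/(prime_set J); case: ifP => // _; congr (_ * _).
by rewrite prodfV prodrXl /set_prod natr_prod.
Qed.

Lemma ler_sum_subseq (s t : seq nat) (g : nat -> R) :
  (forall e, 0 <= g e) -> uniq s -> uniq t -> {subset s <= t} ->
  \sum_(e <- s) g e <= \sum_(e <- t) g e.
Proof.
move=> g0 us ut st; rewrite [leRHS](bigID (mem s)) /= -[X in _ <= X + _]big_filter.
rewrite [X in _ <= X + _](perm_big s) /=; last first.
  apply: uniq_perm; rewrite ?filter_uniq// => x.
  by rewrite mem_filter; apply/andP/idP => [[]//|xs]; split => //; exact: st.
by rewrite lerDl sumr_ge0.
Qed.

(** Distinct prime sets have distinct squarefree products, so the sum over sets is part of a sum
    over squarefree integers. [Z] lies beyond all products and is enormous; later bounds are uniform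
    in it. *)
Lemma sum_prime_sets_le (g : nat -> R) : (forall e, 0 <= g e) ->
  exists Z : nat, \sum_(J | prime_set J) g (set_prod J)
    <= \sum_(1 <= e < Z | sqf e) g e.
Proof.
move=> g0; exists (\max_(J | prime_set J) set_prod J)%N.+1.
rewrite -[leLHS]big_enum /= -(big_map set_prod xpredT) -[leRHS]big_filter.
apply: ler_sum_subseq => //.
- by rewrite map_inj_in_uniq ?enum_uniq// => J K; rewrite !mem_enum; exact: set_prod_inj.
- by rewrite filter_uniq// iota_uniq.
move=> e /mapP[J]; rewrite mem_enum => hJ ->.
rewrite mem_filter sqf_set_prod// mem_index_iota set_prod_gt0//= ltnS.
exact: (@leq_bigmax_cond _ _ set_prod J).
Qed.

End PrimeSets.

(** * Decreasing weights, their multiples and the density of squarefree integers *)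

Section Blocks.
Variable R : realFieldType.
Implicit Types (f : nat -> R) (B : R).

Lemma modnS_eq (m u : nat) : (0 < u)%N -> (u %| m.+1)%N -> (m %% u).+1 = u.
Proof.
move=> u0 um; have := modnS m u; rewrite um => e0.
have lt := ltn_pmod m u0.
have : (u %| (m %% u).+1)%N by rewrite /dvdn -addn1 modnDml addn1 -/(dvdn u m.+1).
move/dvdn_leq => /(_ isT) h; lia.
Qed.

(** Each multiple of [u] carries the smallest value of the block of [u] integers ending there, and
    at least every value of the next block. The difference is therefore nonnegative and at most u
    f(0). *)
Lemma block_sum_bounds f B (u N : nat) : (0 < u)%N ->
  (forall n, 0 <= f n) -> (forall n, f n.+1 <= f n) -> f 0%N <= B ->
  0 <= \sum_(1 <= n < N.+1) f n - u%:R * \sum_(1 <= n < N.+1 | (u %| n)%N) f n <= u%:R * B.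
Proof.
move=> u0 f0 fS fB.
(* The induction must record the unfinished block, which has [N %% u] terms, each at least [f N]. *)
suff h : (N %% u)%:R * f N <= \sum_(1 <= n < N.+1) f n - u%:R * \sum_(1 <= n < N.+1 | (u %| n)%N) f n
    <= u%:R * B - (u%:R - 1 - (N %% u)%:R) * f N.
  have lt := ltn_pmod N u0; have {}lt : (N %% u)%:R + 1 <= u%:R :> R by rewrite natr1 ler_nat.
  case/andP: h => h1 h2; apply/andP; split; first by apply: le_trans h1; rewrite mulr_ge0.
  by apply: le_trans h2 _; rewrite gerBl mulr_ge0//; lra.
have u1 : 1 <= u%:R :> R by rewrite ler1n.
elim: N => [|N IH].
  rewrite !big_geq// mod0n mulr0 subr0 mul0r lexx /= subr0.
  have : f 0%N <= B by []; have := f0 0%N; nra.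
rewrite big_nat_recr//= [X in _ - _ * X]big_mkcond [X in _ - _ * X]big_nat_recr//= -big_mkcond /=.
move: IH; set S := \sum_(_ <= _ < _) _; set F := \sum_(_ <= _ < _ | _) _ => IH.
have lt := ltn_pmod N u0; have {}lt : (N %% u)%:R + 1 <= u%:R :> R by rewrite natr1 ler_nat.
have := fS N; have := f0 N; have := f0 N.+1; rewrite modnS.
have r0 : 0 <= (N %% u)%:R :> R by [].
case: ifPn => um.
  have e := modnS_eq _ _ u0 um.
  have {}e : (N %% u)%:R + 1 = u%:R :> R by rewrite natr1 e.
  move: IH lt e r0; move: ((N %% u)%:R) (f N) (f N.+1) => r a b; rewrite mul0r.
  by move=> *; nra.
rewrite -natr1 addr0.
move: IH lt r0; move: ((N %% u)%:R) (f N) (f N.+1) => r a b.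
by move=> *; nra.
Qed.

(** When x = D^2 B, the product [B * decay D n] is min(B, x/n^2). *)
Definition decay (D : R) (n : nat) : R := Num.min 1 (D ^+ 2 / n%:R ^+ 2).

Lemma decay_ge0 D n : 0 <= decay D n.
Proof. by rewrite /decay le_min ler01 divr_ge0 ?sqr_ge0. Qed.

Lemma decay_le1 D n : decay D n <= 1.
Proof. by rewrite /decay ge_min lexx. Qed.

(** The right side is the integral of min(1, D^2/t^2) over [0, K]. *)
Lemma sum_decay_le_ind (D : R) (K : nat) : 0 < D ->
  \sum_(1 <= n < K.+1) decay D n <= if K%:R <= D then K%:R else 2 * D - D ^+ 2 / K%:R.
Proof.
move=> D0; elim: K => [|K IH]; first by rewrite big_geq// (ltW D0).
rewrite big_nat_recr//=.
apply: le_trans (lerD IH (lexx _)) _ => {IH}.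
have t0 : 0 < K.+1%:R :> R by rewrite ltr0n.
have eK : K%:R = K.+1%:R - 1 :> R by rewrite -natr1 addrK.
have [KD|KD] := leP (K.+1%:R : R) D.
  have -> : (K%:R : R) <= D by lra.
  by rewrite -natr1 lerD2l decay_le1.
have h2 : decay D K.+1 <= D ^+ 2 / K.+1%:R ^+ 2 by rewrite /decay ge_min lexx orbT.
apply: le_trans (lerD (lexx _) h2) _.
have [KD'|KD'] := leP (K%:R : R) D.
  rewrite {}eK in KD' *; move: t0 KD KD'; move: (K.+1%:R) => t t0 tD tD'.
  rewrite -subr_ge0.
  (* This is the step that crosses [D]: since t - D <= 1, the factor (D + t) - t (t - D) stays
     positive. *)
  have -> : 2 * D - D ^+ 2 / t - (t - 1 + D ^+ 2 / t ^+ 2) =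
     (t - D) * ((D + t) - t * (t - D)) / t ^+ 2 by field; rewrite gt_eqF.
  rewrite divr_ge0 ?sqr_ge0// mulr_ge0//; first lra.
  have : t * (t - D) <= t * 1 by rewrite ler_pM2l//; lra.
  lra.
have K0 : 0 < (K%:R : R) by lra.
rewrite -subr_ge0 {}eK in K0 *; move: t0 K0 KD; move: (K.+1%:R) => t t0 K0 tD.
have -> : 2 * D - D ^+ 2 / t - (2 * D - D ^+ 2 / (t - 1) + D ^+ 2 / t ^+ 2) =
   D ^+ 2 / (t ^+ 2 * (t - 1)) by field; rewrite !gt_eqF.
by rewrite divr_ge0 ?sqr_ge0// mulr_ge0 ?sqr_ge0// ltW.
Qed.

Lemma sum_decay_le (D : R) (K : nat) : 0 < D ->
  \sum_(1 <= n < K.+1) decay D n <= 2 * D.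
Proof.
move=> D0; apply: le_trans (sum_decay_le_ind D K D0) _.
case: ifP => [|_]; first lra.
by rewrite gerBl divr_ge0 ?sqr_ge0.
Qed.

Lemma sum_decay_le_cut (D : R) (K : nat) : 0 < D <= K%:R ->
  \sum_(1 <= n < K.+1) decay D n <= 2 * D - D ^+ 2 / K%:R.
Proof.
move=> /andP[D0 DK]; apply: le_trans (sum_decay_le_ind D K D0) _.
case: ifP => // KD; have -> : K%:R = D by apply/le_anti; rewrite KD DK.
by rewrite le_eqVlt; apply/orP; left; apply/eqP; field; rewrite gt_eqF.
Qed.

Lemma decay_anti D (m n : nat) : (0 < m <= n)%N -> decay D n <= decay D m.
Proof.
move=> /andP[m0 mn]; rewrite /decay le_min !ge_min lexx /=; apply/orP; right.
rewrite ler_wpM2l ?sqr_ge0// lef_pV2 ?posrE ?exprn_gt0 ?ltr0n//; last by lia.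
by rewrite lerXn2r ?nnegrE ?ler0n// ler_nat.
Qed.

Lemma decay_block_bounds (D : R) (u N : nat) : (0 < u)%N ->
  0 <= \sum_(1 <= n < N.+1) decay D n - u%:R * \sum_(1 <= n < N.+1 | (u %| n)%N) decay D n <= u%:R.
Proof.
(* Division by zero makes [decay D 0] equal to 0; the value 1 there restores monotonicity. *)
move=> u0; pose f n := if n is 0%N then 1 else decay D n.
have e (P : pred nat) : \sum_(1 <= n < N.+1 | P n) decay D n = \sum_(1 <= n < N.+1 | P n) f n.
  rewrite big_nat_cond [RHS]big_nat_cond; by apply: eq_bigr => -[|n].
rewrite !e; suff : 0 <= \sum_(1 <= n < N.+1) f n - u%:R * \sum_(1 <= n < N.+1 | (u %| n)%N) f n <= u%:R * 1 by rewrite mulr1.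
 apply: block_sum_bounds => //.
- by case=> [|n]; rewrite /f ?decay_ge0.
- by case=> [|n]; rewrite /f ?decay_le1// decay_anti//=.
Qed.

(* Squarefree integers avoid the multiples of 4 and of 9. *)
Lemma sum_sqf_decay_le (D : R) (Z : nat) : 0 < D ->
  \sum_(1 <= e < Z | sqf e) decay D e <= 4 / 3 * D + 2.
Proof.
move=> D0; case: Z => [|Z]; first by rewrite big_geq//; lra.
(* The density 1 - 1/4 - 1/9 + 1/36 = 2/3 applied to 2 D gives 4/3 D; the two subtracted sums lose
   at most 1 each. *)
apply: (@le_trans _ _ (\sum_(1 <= n < Z.+1) decay D n - \sum_(1 <= n < Z.+1 | (4 %| n)%N) decay D n
   - \sum_(1 <= n < Z.+1 | (9 %| n)%N) decay D n + \sum_(1 <= n < Z.+1 | (36 %| n)%N) decay D n)).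
  rewrite big_mkcond [X in _ - X - _ + _]big_mkcond [X in _ - _ - X + _]big_mkcond [X in _ <= _ + X]big_mkcond /=.
  rewrite -!sumrB -big_split /= big_nat_cond [leRHS]big_nat_cond.
  apply: ler_sum => n /andP[/andP[n1 _] _].
  have d0 := decay_ge0 D n.
  have e36 : (36 %| n)%N = (4 %| n)%N && (9 %| n)%N by rewrite -(@Gauss_dvd 4 9).
  have h4 : sqf n -> ~~ (4 %| n)%N by move=> /(sqfP _ n1) /(_ 2%N isT).
  have h9 : sqf n -> ~~ (9 %| n)%N by move=> /(sqfP _ n1) /(_ 3%N isT).
  rewrite e36; case: (sqf n) h4 h9 => [/(_ isT) /negPf -> /(_ isT) /negPf ->|_ _]; first by rewrite /=; lra.
  by case: (4 %| n)%N; case: (9 %| n)%N => /=; lra.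
have := sum_decay_le D Z D0.
have := decay_block_bounds D 4 Z isT; have := decay_block_bounds D 9 Z isT; have := decay_block_bounds D 36 Z isT.
set a := \sum_(_ <= _ < _) _; set b := \sum_(_ <= _ < _ | (4 %| _)%N) _.
set c := \sum_(_ <= _ < _ | (9 %| _)%N) _; set d := \sum_(_ <= _ < _ | _) _.
by move: a b c d => a b c d; lra.
Qed.

Lemma sum_sqf_decay_le2 (D : R) (Z : nat) : 0 < D ->
  \sum_(1 <= e < Z | sqf e) decay D e <= 2 * D.
Proof.
move=> D0; case: Z => [|Z]; first by rewrite big_geq//; lra.
apply: le_trans (sum_decay_le D Z D0); rewrite big_mkcond.
by apply: ler_sum => n _; case: ifP => // _; exact: decay_ge0.
Qed.

(* The multiples of e^2 are compared with e^(-2) times the full range, for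
   every product e of distinct primes. *)
Lemma sum_sqf_approx f B G (M N : nat) : (N <= M)%N ->
  (forall n, 0 <= f n) -> (forall n, f n.+1 <= f n) -> f 0%N <= B ->
  0 < B -> 0 < G -> \sum_(1 <= n < N.+1) f n <= G ^+ 2 * B ->
  exists Z : nat,
  `|\sum_(1 <= n < N.+1 | sqf n) f n - kappa M R * \sum_(1 <= n < N.+1) f n|
  <= B * \sum_(1 <= e < Z | sqf e) decay G e.
Proof.
move=> NM f0 fS fB B0 G0 IG; set I := \sum_(1 <= n < N.+1) f n.
have [Z hZ] := sum_prime_sets_le M R (fun e => B * decay G e) (fun e => mulr_ge0 (ltW B0) (decay_ge0 G e)).
exists Z; rewrite [leRHS]mulr_sumr; apply: (le_trans _ hZ).
rewrite (sum_sqf_prime_sets M)// /kappa mulr_suml -sumrB.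
apply: le_trans (ler_norm_sum _ _ _) _; apply: ler_sum => J hJ.
have e0 := set_prod_gt0 _ _ hJ; set e := set_prod M J in e0 *.
have e20 : (0 < e ^ 2)%N by rewrite expn_gt0 e0.
have := block_sum_bounds f B (e ^ 2) N e20 f0 fS fB; rewrite -/I.
set F := \sum_(_ <= _ < _ | _) _ => bb.
have F0 : 0 <= F by rewrite sumr_ge0.
rewrite -mulrA -mulrBr normrM normrX normrN1 expr1n mul1r.
have v0 : 0 < (e ^ 2)%:R :> R by rewrite ltr0n.
rewrite natrX in bb v0; set v := e%:R ^+ 2 in bb v0 *.
have -> : v^-1 * I = F + (I - v * F) / v by field; rewrite gt_eqF.
rewrite opprD addrA subrr add0r normrN ger0_norm; last by rewrite divr_ge0 ?(ltW v0)//; case/andP: bb.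
(* Two bounds for the error at e: block comparison gives B, and the full sum over e^2 gives at most
   G^2 B/e^2. Their minimum is [B * decay G e]. *)
rewrite /decay -/v minr_pMr ?(ltW B0)// mulr1 le_min; apply/andP; split.
  by rewrite ler_pdivrMr// (mulrC B); case/andP: bb.
rewrite mulrA ler_pM2r ?invr_gt0// (mulrC B).
by apply: le_trans IG; rewrite gerBl mulr_ge0// ltW.
Qed.

(** Replacing the primes by all integers only lowers the product, which then telescopes by 1 - 1/i^2
    = (i - 1)(i + 1)/i^2. *)
Lemma prod_one_sub_inv_sqr_ge (n m : nat) : (1 < n)%N ->
  (n%:R - 1) / n%:R * ((n + m)%:R / ((n + m)%:R - 1)) <=
  \prod_(n <= i < n + m) (1 - (prime i)%:R / i%:R ^+ 2) :> R.
Proof.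
move=> n1; elim: m => [|m IH].
  have : 1 < n%:R :> R by rewrite ltr1n.
  rewrite addn0 big_geq//; move: (n%:R) => t t1.
  have -> // : (t - 1) / t * (t / (t - 1)) = 1.
  by field; rewrite !gt_eqF//; lra.
rewrite addnS big_nat_recr ?leq_addr//=.
have t1 : 1 < (n + m)%:R :> R by rewrite ltr1n; lia.
have t2 : 1 < n%:R :> R by rewrite ltr1n.
have h : 1 - ((n + m)%:R ^+ 2)^-1 <= 1 - (prime (n + m))%:R / (n + m)%:R ^+ 2 :> R.
  rewrite lerD2l lerN2 ler_piMl ?invr_ge0 ?sqr_ge0//.
  by case: prime.
rewrite -natr1; move: IH h t1 t2; set P := \prod_(_ <= _ < _) _; set q := 1 - _ / _.
move: (n%:R) ((n + m)%:R) => u t IH h t1 u1.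
have -> : (u - 1) / u * ((t + 1) / (t + 1 - 1)) = (u - 1) / u * (t / (t - 1)) * (1 - (t ^+ 2)^-1).
  by field; rewrite !gt_eqF//; lra.
apply: ler_pM => //.
- by apply: mulr_ge0; apply: divr_ge0; lra.
- rewrite subr_ge0 invf_le1 ?exprn_gt0 ?expr_ge1//; lra.
Qed.

Lemma kappa_ge (M : nat) : (29 <= M)%N -> 59 / 100 <= kappa M R.
Proof.
move=> M29; rewrite kappaE (@big_cat_nat _ _ _ 29)//=; last by lia.
have tail : 28 / 29 <= \prod_(29 <= i < M.+1) (1 - (prime i)%:R / i%:R ^+ 2) :> R.
  have := @prod_one_sub_inv_sqr_ge 29 (M.+1 - 29) isT.
  rewrite subnKC; last by lia.
  apply: le_trans; have -> : 29%:R - 1 = 28 :> R by lra.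
  have : 1 < M.+1%:R :> R by rewrite ltr1n; lia.
  move: (M.+1%:R) => t t1; rewrite ler_peMr ?divr_ge0//.
  by rewrite ler_pdivlMr; lra.
(* The primes up to 23 give about 0.613, and 0.612 times the tail bound 28/29 still exceeds 0.59. *)
have head : 612 / 1000 <= \prod_(0 <= i < 29) (1 - (prime i)%:R / i%:R ^+ 2) :> R.
  do 29 (rewrite big_ltn//=); rewrite big_geq//.
  lra.
apply: (@le_trans _ _ (612 / 1000 * (28 / 29))); first lra.
by apply: ler_pM => //; lra.
Qed.

Lemma kappa_le1 (M : nat) : kappa M R <= 1.
Proof.
rewrite kappaE prodr_ile1// => i _.
case: (boolP (prime i)) => ip; last by rewrite mul0r subr0 ler01 lexx.
rewrite mul1r gerBl invr_ge0 sqr_ge0 andbT subr_ge0.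
rewrite invf_le1 ?exprn_gt0 ?ltr0n ?prime_gt0// expr_ge1// ?ler1n ?prime_gt0//.
Qed.

End Blocks.

(** * Character sums and the sieve *)

Lemma sum_dvdn_reindex (A : nmodType) (f : nat -> A) (d X : nat) : (0 < d)%N ->
  \sum_(1 <= n < X.+1 | (d %| n)%N) f n = \sum_(1 <= m < (X %/ d).+1) f (d * m)%N.
Proof.
move=> d0; elim: X => [|X IH]; first by rewrite div0n !big_geq.
rewrite big_mkcond big_nat_recr//= -big_mkcond /= IH divnS//.
case: ifPn => h; last by rewrite add0n addr0.
rewrite add1n [RHS]big_nat_recr//=; congr (_ + f _).
have := divnK h; rewrite divnS// h add1n => <-.
by rewrite mulnC.
Qed.

Section SquarefreeCharacterSums.
Context {R : realType}.
Local Notation C := R[i].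

(** The upper bound for T/B. The second-order term D^2/K is kept, since the hypothesis on G contains
    the matching negative term; [G] will be sqrt(2 D). *)
Lemma sum_sqf_decay_cut (M K : nat) (D G : R) : (29 <= M)%N -> (K <= M)%N ->
  0 < D <= K%:R -> 0 < G -> 2 * D - D ^+ 2 / K%:R <= G ^+ 2 ->
  \sum_(1 <= n < K.+1 | sqf n) decay R D n
    <= kappa M R * (2 * D - D ^+ 2 / K%:R) + (4 / 3 * G + 2).
Proof.
move=> M29 KM DK G0 hG; pose f n := if n is 0%N then 1 else decay R D n.
have e (P : pred nat) : \sum_(1 <= n < K.+1 | P n) decay R D n = \sum_(1 <= n < K.+1 | P n) f n.
  by rewrite big_nat_cond [RHS]big_nat_cond; apply: eq_bigr => -[|n].
have I_le : \sum_(1 <= n < K.+1) f n <= 2 * D - D ^+ 2 / K%:R by rewrite -e; exact: sum_decay_le_cut.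
have [||||Z hZ] := @sum_sqf_approx R f 1 G M K KM _ _ _ ltr01 G0.
- by case=> [|n]; rewrite /f ?decay_ge0.
- by case=> [|n]; rewrite /f ?decay_le1// decay_anti//=.
- by [].
- by rewrite mulr1; apply: le_trans hG.
rewrite e; rewrite mul1r in hZ.
have h2 := sum_sqf_decay_le R G Z G0.
have k0 := kappa_ge R M M29.
have h3 : kappa M R * \sum_(1 <= n < K.+1) f n <= kappa M R * (2 * D - D ^+ 2 / K%:R).
  by rewrite ler_wpM2l//; lra.
move: hZ; rewrite ler_norml => /andP[_]; rewrite lerBlDl => h4.
by apply: le_trans h4 _; exact: lerD.
Qed.

Lemma sum_sqf_count_ge (M X : nat) (G : R) : (X <= M)%N -> 0 < G -> X%:R <= G ^+ 2 ->
  kappa M R * X%:R - 2 * G <= (\sum_(1 <= n < X.+1 | sqf n) 1)%N%:R.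
Proof.
move=> XM G0 hG.
have [||||Z hZ] := @sum_sqf_approx R (fun=> 1) 1 G M X XM _ _ _ ltr01 G0.
- by [].
- by [].
- by [].
- by rewrite sumr_const_nat subn1 mulr1.
have h2 := sum_sqf_decay_le2 R G Z G0.
rewrite natr_sum; move: hZ; rewrite sumr_const_nat subn1 mul1r ler_norml -pred_Sn => /andP[+ _].
by rewrite lerBrDl; apply: le_trans; rewrite lerD2l lerN2.
Qed.

Section Character.
Variable p : nat.
Hypothesis p_prime : prime p.
Variable chi : 'F_p -> C.
Hypothesis chiM : forall a b, chi (a * b) = chi a * chi b.
Hypothesis chi_le1 : forall a, `|chi a| <= 1.

(** Multiplicativity pulls chi(e^2) out of the sum over multiples of e^2. What remains is an
    incomplete sum of length X/e^2, bounded both by [B] and by its number of terms. *)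
Lemma norm_sum_sqf_chi_le (X K : nat) (B D : R) : (X < p)%N -> 0 < B -> 0 < D ->
  (K ^ 2 <= X < K.+1 ^ 2)%N -> X%:R <= D ^+ 2 * B ->
  (forall N, (N < p)%N -> `|\sum_(1 <= i < N.+1) chi i%:R| <= B%:C) ->
  `|\sum_(1 <= n < X.+1 | sqf n) chi n%:R|
    <= (B * \sum_(1 <= e < K.+1 | sqf e) decay R D e)%:C.
Proof.
move=> Xp B0 D0 /andP[KX XK] XB hB.
(* Beyond [K] the square e^2 exceeds [X], so there is no multiple left to sum over. *)
pose g e : R := if (e <= K)%N then B * decay R D e else 0.
have g0 e : 0 <= g e by rewrite /g; case: ifP => // _; rewrite mulr_ge0 ?decay_ge0 ?ltW.
have [Z hZ] := sum_prime_sets_le p R g g0.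
have hZ2 : \sum_(1 <= e < Z | sqf e) g e <= B * \sum_(1 <= e < K.+1 | sqf e) decay R D e.
  rewrite mulr_sumr.
  have -> : \sum_(1 <= e < K.+1 | sqf e) B * decay R D e = \sum_(1 <= e < K.+1 | sqf e) g e.
    rewrite big_nat_cond [RHS]big_nat_cond; apply: eq_bigr => e /andP[/andP[_ eK] _].
    by rewrite /g -ltnS eK.
  rewrite (bigID (fun e => (e <= K)%N)) /= [X in _ + X]big1 ?addr0; last first.
    by move=> e /andP[_ /negPf eK]; rewrite /g eK.
  rewrite -[leLHS]big_filter -[leRHS]big_filter.
  apply: ler_sum_subseq => //; rewrite ?filter_uniq ?iota_uniq//.
  by move=> e; rewrite !mem_filter !mem_index_iota => /andP[/andP[-> eK] /andP[-> _]].
apply: le_trans (_ : _ <= (\sum_(J | prime_set p J) g (set_prod p J))%:C) _; last first.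
  by rewrite lecR; apply: le_trans hZ2.
rewrite (sum_sqf_prime_sets p)//; last exact: ltnW.
apply: le_trans (ler_norm_sum _ _ _) _; rewrite rmorph_sum.
apply: ler_sum => J hJ; rewrite normrM normrX normrN1 expr1n mul1r.
have e0 := set_prod_gt0 _ _ hJ; set e := set_prod p J in e0 *.
have e20 : (0 < e ^ 2)%N by rewrite expn_gt0 e0.
rewrite sum_dvdn_reindex//.
have -> : \sum_(1 <= m < (X %/ e ^ 2).+1) chi (e ^ 2 * m)%:R =
   chi (e ^ 2)%:R * \sum_(1 <= m < (X %/ e ^ 2).+1) chi m%:R.
  by rewrite mulr_sumr; apply: eq_bigr => m _; rewrite natrM chiM.
have [eK|eK] := leqP e K; last first.
  rewrite divn_small; last by apply: leq_trans XK _; rewrite leq_exp2r.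
  by rewrite big_geq// mulr0 normr0 /g leqNgt eK.
rewrite /g eK normrM; set N := (X %/ e ^ 2)%N.
have Np : (N < p)%N by apply: leq_ltn_trans Xp; exact: leq_div.
apply: (@le_trans _ _ (1 * `|\sum_(1 <= m < N.+1) chi m%:R|)).
  by rewrite ler_wpM2r.
rewrite mul1r /decay minr_pMr ?(ltW B0)// mulr1.
have hN : `|\sum_(1 <= m < N.+1) chi m%:R| <= (B * (D ^+ 2 / e%:R ^+ 2))%:C.
  apply: (@le_trans _ _ (N%:R : C)).
    apply: le_trans (ler_norm_sum _ _ _) _.
    apply: le_trans (ler_sum _ (fun i _ => chi_le1 _)) _.
    by rewrite sumr_const_nat subn1.
  rewrite -(rmorph_nat (real_complex R)) lecR mulrA ler_pdivlMr ?exprn_gt0 ?ltr0n//.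
  rewrite mulrC (mulrC B); apply: le_trans XB.
  by rewrite -natrX -natrM ler_nat mulnC leq_trunc_div.
have [le|le] := leP B (B * (D ^+ 2 / e%:R ^+ 2)); first exact: hB.
exact: hN.
Qed.

End Character.
End SquarefreeCharacterSums.

(** * Discrete logarithms and Dirichlet characters *)

Section DiscreteLogarithm.
Context {R : realType}.
Local Notation C := R[i].
Variable p : nat.
Hypothesis p_prime : prime p.

Lemma Fp_nat_eq0 (n : nat) : ((n%:R : 'F_p) == 0) = (p %| n)%N.
Proof.
by rewrite -(inj_eq val_inj) /= val_Fp_nat.
Qed.

Lemma Fp_fermat (a : 'F_p) : a != 0 -> a ^+ p.-1 = 1.
Proof.
move=> a0; have h : a ^+ p = a.
  rewrite -[a]natr_Zp -natrX; apply/val_inj.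
  by rewrite /= !val_Fp_nat// fermat_little.
by apply: (mulfI a0); rewrite -exprS prednK ?prime_gt0// h mulr1.
Qed.

Lemma primitive_root_exists : exists g : 'F_p, (p.-1).-primitive_root g.
Proof.
have p1 : (0 < p.-1)%N by have := prime_gt1 p_prime; lia.
have /hasP[g _ gP] : has (p.-1).-primitive_root (enum [pred x : 'F_p | x != 0]).
  apply: has_prim_root => //; last by rewrite -cardE (card_nz p p_prime).
    by apply/allP => x; rewrite mem_enum /= => x0; apply/unity_rootP; exact: Fp_fermat.
  exact: enum_uniq.
by exists g.
Qed.

Variable g : 'F_p.
Hypothesis g_prim : (p.-1).-primitive_root g.

(** The index, or discrete logarithm, of [a] to the base [g], with default 0 at a = 0. *)
Definition ind (a : 'F_p) : nat :=
  if [pick i : 'I_p.-1 | a == g ^+ i] is Some i then i : nat else 0%N.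

Lemma expr_ind a : a != 0 -> g ^+ ind a = a.
Proof.
move=> a0; rewrite /ind; case: pickP => [i /eqP ->//|h].
by have [i e] := prim_rootP g_prim (Fp_fermat a a0); move: (h i); rewrite e eqxx.
Qed.

Lemma g_neq0 : g != 0.
Proof.
apply/eqP => g0; have := prim_expr_order g_prim; rewrite g0 expr0n.
by rewrite gtn_eqF ?(prim_order_gt0 g_prim)//= => /eqP; rewrite eq_sym oner_eq0.
Qed.

Definition dchar (j : nat) (a : 'F_p) : C :=
  if a == 0 then 0 else zeta p.-1 ^+ (j * ind a).

Lemma zeta_ind_expr (j i : nat) : zeta (R := R) p.-1 ^+ (j * ind (g ^+ i)) = zeta p.-1 ^+ (j * i).
Proof.
have p1 := prim_order_gt0 g_prim.
have gi0 : g ^+ i != 0 by rewrite expf_neq0// g_neq0.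
have /eqP := expr_ind _ gi0; rewrite (eq_prim_root_expr g_prim) => /eqP e.
by rewrite -(zetaX_mod _ p1) -modnMmr e modnMmr zetaX_mod.
Qed.

Lemma dcharM j a b : dchar j (a * b) = dchar j a * dchar j b.
Proof.
rewrite /dchar mulf_eq0; case: eqP => [|/eqP a0]; first by rewrite mul0r.
case: eqP => [|/eqP b0]; first by rewrite mulr0.
rewrite /= -[in LHS](expr_ind _ a0) -[in LHS](expr_ind _ b0) -exprD zeta_ind_expr.
by rewrite mulnDr exprD.
Qed.

Lemma norm_dchar j a : a != 0 -> `|dchar j a| = 1.
Proof. by move=> a0; rewrite /dchar (negPf a0) norm_zetaX. Qed.

Lemma dchar0 j : dchar j 0 = 0.
Proof. by rewrite /dchar eqxx. Qed.

Lemma dchar_le1 j a : `|dchar j a| <= 1.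
Proof. by have [->|a0] := eqVneq a 0; rewrite ?dchar0 ?normr0 ?norm_dchar. Qed.

Lemma sum_dchar j : ~~ (p.-1 %| j)%N -> \sum_a dchar j a = 0.
Proof.
move=> hj; have p1 := prim_order_gt0 g_prim.
have h : dchar j g * \sum_a dchar j a = \sum_a dchar j a.
  rewrite [RHS](reindex_inj (mulfI g_neq0)) /= mulr_sumr.
  by apply: eq_bigr => a _; rewrite dcharM.
have e : dchar j g = zeta p.-1 ^+ j.
  by rewrite /dchar (negPf g_neq0) -[g in ind g]expr1 zeta_ind_expr muln1.
have g1 : dchar j g - 1 != 0 by rewrite subr_eq0 e zetaX_eq1.
by apply: (mulfI g1); rewrite mulr0 mulrBl mul1r h subrr.
Qed.

Lemma primitive_root_of_ind (n : nat) : ~~ (p %| n)%N ->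
  (forall l, prime l -> (l %| p.-1)%N -> ~~ (l %| ind n%:R)%N) -> primitive_root_mod p n.
Proof.
move=> pn hl; split; first by rewrite coprime_sym prime_coprime.
have n0 : (n%:R : 'F_p) != 0 by rewrite Fp_nat_eq0.
rewrite -(expr_ind _ n0) (prim_root_exp_coprime _ g_prim).
have p1 := prim_order_gt0 g_prim.
rewrite /coprime eqn_leq gcdn_gt0 p1 orbT andbT leqNgt; apply/negP => h.
have := pdiv_prime h; have := pdiv_dvd (gcdn (ind n%:R) p.-1).
rewrite dvdn_gcd => /andP[d1 d2] /hl /(_ d2); by rewrite d1.
Qed.

End DiscreteLogarithm.

(** * The sieve on exponents, with a core and sieving primes *)

Section Sieve.
Context {R : realType}.
Local Notation C := R[i].
(* T is a multiset of exponents, to be read modulo m: in the application, the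
   discrete logarithms of the squarefree integers. *)
Variables (m : nat) (T : seq nat) (S : R).
Hypothesis m_gt0 : (0 < m)%N.

Definition psi (j t : nat) : C := zeta m ^+ (j * t).

Definition Lam (u : nat -> C) : C := \sum_(t <- T) u t.

Hypothesis Lam_psi : forall j, ~~ (m %| j)%N -> `|Lam (psi j)| <= S%:C.

Definition cop (ls : seq nat) (t : nat) : bool := all (fun l => ~~ (l %| t)%N) ls.

Definition theta (ls : seq nat) : R := \prod_(l <- ls) (1 - l%:R^-1).

Lemma psiD i j t : psi (i + j) t = psi i t * psi j t.
Proof. by rewrite /psi mulnDl exprD. Qed.

Lemma sum_psi_div l t : (0 < l)%N -> (l %| m)%N ->
  \sum_(0 <= j < l) psi (m %/ l * j) t = if (l %| t)%N then l%:R else 0.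
Proof.
move=> l0 lm; set w := zeta (R := R) m ^+ (m %/ l * t).
have e j : psi (m %/ l * j) t = w ^+ j by rewrite /psi /w -exprM mulnAC.
have ml0 : (0 < m %/ l)%N by rewrite divn_gt0// dvdn_leq.
have w1 : (w == 1) = (l %| t)%N.
  by rewrite /w zetaX_eq1// -{1}(divnK lm) dvdn_pmul2l.
under eq_bigr => j _ do rewrite e.
case: ifP w1 => [_ /eqP ->|_ /negbT w1].
  by under eq_bigr => j _ do rewrite expr1n; rewrite sumr_const_nat subn0.
have w1' : w - 1 != 0 by rewrite subr_eq0.
apply: (mulfI w1'); rewrite big_mkord -subrX1 mulr0 /w -exprM.
have -> : (m %/ l * t * l = m * t)%N by rewrite mulnAC divnK.
by rewrite exprM zeta_order// expr1n subrr.
Qed.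

(** Orthogonality of the [l] characters of order dividing [l], with the trivial one set apart as
    main term. *)
Lemma not_dvd_expansion l t : (0 < l)%N -> (l %| m)%N ->
  (~~ (l %| t)%N)%:R = (1 - l%:R^-1) - l%:R^-1 * \sum_(1 <= j < l) psi (m %/ l * j) t :> C.
Proof.
move=> l0 lm; have := sum_psi_div l t l0 lm; rewrite big_ltn//.
have -> : psi (m %/ l * 0) t = 1 by rewrite /psi muln0 mul0n expr0.
set s := \sum_(_ <= _ < _) _ => h.
have l0' : l%:R != 0 :> C by rewrite pnatr_eq0 -lt0n.
have -> : s = (if (l %| t)%N then l%:R else 0) - 1 by rewrite -h addrC addKr.
by case: ifP => _ /=; field.
Qed.

Lemma Lam_cons l ls j : (0 < l)%N -> (l %| m)%N ->
  Lam (fun t => (cop (l :: ls) t)%:R * psi j t) =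
  (1 - l%:R^-1) * Lam (fun t => (cop ls t)%:R * psi j t)
  - l%:R^-1 * \sum_(1 <= i < l) Lam (fun t => (cop ls t)%:R * psi (j + m %/ l * i) t).
Proof.
move=> l0 lm; rewrite /Lam exchange_big /= !mulr_sumr -sumrB; apply: eq_bigr => t _.
rewrite -mulnb natrM not_dvd_expansion// -mulrA mulrBl -mulrA; congr (_ - _).
congr (_ * _); rewrite mulr_suml; apply: eq_bigr => i _.
by rewrite psiD; ring.
Qed.

Lemma theta_cons l ls : theta (l :: ls) = (1 - l%:R^-1) * theta ls.
Proof. by rewrite /theta big_cons. Qed.

Lemma one_sub_inv_ge0 l : (0 < l)%N -> 0 <= 1 - l%:R^-1 :> R.
Proof. by move=> l0; rewrite subr_ge0 invf_le1 ?ltr0n// ler1n. Qed.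

Lemma sum_bound (l : nat) (F : nat -> C) (B : R) : (0 < l)%N ->
  (forall i, (0 < i < l)%N -> `|F i| <= B%:C) ->
  `|l%:R^-1 * \sum_(1 <= i < l) F i| <= ((1 - l%:R^-1) * B)%:C.
Proof.
move=> l0 hF; have l0' : (0 : R) < l%:R by rewrite ltr0n.
rewrite normrM ger0_norm ?invr_ge0//.
have -> : ((1 - l%:R^-1) * B)%:C = l%:R^-1 * ((l.-1)%:R * B)%:C.
  rewrite -(rmorph_nat (real_complex R)) -fmorphV -rmorphM /=; congr (_%:C).
  by rewrite -subn1 natrB//; field; rewrite gt_eqF.
rewrite ler_pM2l ?invr_gt0 ?ltr0n//.
apply: le_trans (ler_norm_sum _ _ _) _.
apply: (@le_trans _ _ (\sum_(1 <= i < l) B%:C)).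
  by rewrite big_nat_cond [leRHS]big_nat_cond; apply: ler_sum => i /andP[hi _]; exact: hF.
by rewrite sumr_const_nat subn1 rmorphM /= rmorph_nat mulr_natl.
Qed.

Lemma norm_one_sub_inv l : (0 < l)%N -> `|1 - l%:R^-1 : C| = (1 - l%:R^-1)%:C.
Proof.
move=> l0; have -> : 1 - l%:R^-1 = (1 - l%:R^-1)%:C :> C by rewrite rmorphB rmorph1 fmorphV rmorph_nat.
by rewrite ger0_norm// lecR one_sub_inv_ge0.
Qed.

(** Each prime of the list doubles the bound: the trivial character contributes the weight 1 - 1/l,
    and the l - 1 others, weighted 1/l, the same again. The divisibility condition on [j] ensures
    that no frequency met in the expansion becomes trivial. *)
Lemma Lam_cop_psi ls j : all (fun l => (0 < l)%N && (l %| m)%N) ls ->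
  ~~ (m %| j * \prod_(l <- ls) l)%N ->
  `|Lam (fun t => (cop ls t)%:R * psi j t)| <= (theta ls * 2 ^+ size ls * S)%:C.
Proof.
elim: ls j => [|l ls IH] j /=.
  rewrite big_nil muln1 => _ hj; rewrite /theta big_nil mulr1 mul1r.
  by rewrite (_ : Lam _ = Lam (psi j)) ?Lam_psi//; apply: eq_bigr => t _; rewrite mul1r.
move=> /andP[/andP[l0 lm] hls]; rewrite big_cons => hj.
rewrite Lam_cons//; apply: le_trans (ler_normB _ _) _.
set B := theta ls * 2 ^+ size ls * S.
have h1 : `|Lam (fun t => (cop ls t)%:R * psi j t)| <= B%:C.
  apply: IH => //; apply: contra hj => h.
  by rewrite mulnCA dvdn_mull.
have h2 i : (0 < i < l)%N -> `|Lam (fun t => (cop ls t)%:R * psi (j + m %/ l * i) t)| <= B%:C.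
  move=> _; apply: IH => //; apply: contra hj => h.
  have : (m %| (j + m %/ l * i) * (\prod_(l0 <- ls) l0) * l)%N by rewrite dvdn_mulr.
  rewrite mulnDl mulnDl.
  have -> : (m %/ l * i * (\prod_(l0 <- ls) l0) * l = m * (i * \prod_(l0 <- ls) l0))%N.
    by rewrite -{2}(divnK lm); ring.
  by rewrite (dvdn_addl _ (dvdn_mulr _ (dvdnn m))) -mulnA [(_ * l)%N]mulnC.
have -> : (theta (l :: ls) * 2 ^+ (size ls).+1 * S)%:C = ((1 - l%:R^-1) * B)%:C + ((1 - l%:R^-1) * B)%:C.
  by rewrite -rmorphD theta_cons /B exprS; congr (_%:C); ring.
apply: lerD; last exact: sum_bound.
rewrite normrM norm_one_sub_inv// rmorphM ler_wpM2l// lecR; exact: one_sub_inv_ge0.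
Qed.

Lemma prime_ndvd_prod l ls : prime l -> all prime ls -> l \notin ls ->
  ~~ (l %| \prod_(l' <- ls) l')%N.
Proof.
move=> lp /allP hp lls; rewrite Euclid_dvd_prod// big_has; apply/hasP => -[q qls].
by rewrite (dvdn_prime2 lp (hp q qls)) => /eqP e; move: lls; rewrite e qls.
Qed.

(** Comparing with (1 - 1/l) times the count for [ls] cancels the trivial character of [l]. The
    remaining frequencies are never trivial, as [l] divides neither i nor the product of [ls]. *)
Lemma Lam_cop_cons l ls : prime l -> (l %| m)%N -> all prime ls ->
  all (fun l => l %| m)%N ls -> l \notin ls ->
  `|Lam (fun t => (cop (l :: ls) t)%:R) - (1 - l%:R^-1) * Lam (fun t => (cop ls t)%:R)|
  <= ((1 - l%:R^-1) * (theta ls * 2 ^+ size ls * S))%:C.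
Proof.
move=> lp lm pls mls lls; have l0 := prime_gt0 lp.
have e ks : Lam (fun t => (cop ks t)%:R) = Lam (fun t => (cop ks t)%:R * psi 0 t).
  by apply: eq_bigr => t _; rewrite /psi mul0n expr0 mulr1.
rewrite !e Lam_cons// addrAC subrr add0r normrN; apply: sum_bound => // i /andP[i0 il].
apply: Lam_cop_psi.
  by apply/allP => q qls; move/allP: pls => /(_ q qls) /prime_gt0 ->; move/allP: mls; exact.
have : ~~ (l %| i * \prod_(l' <- ls) l')%N.
  by rewrite Euclid_dvdM// negb_or prime_ndvd_prod// andbT gtnNdvd.
apply: contra => d; have : (m %/ l * l %| m %/ l * (i * \prod_(l' <- ls) l'))%N.
  by rewrite (divnK lm) mulnA.
by rewrite dvdn_pmul2l// divn_gt0// dvdn_leq.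
Qed.

(** The errors of the successive primes, weighted 1, 2, 4 and so on, add up to 2^|ls| - 1; the
    trivial character is evaluated exactly. *)
Lemma Lam_cop ls : uniq ls -> all prime ls -> all (fun l => l %| m)%N ls ->
  `|Lam (fun t => (cop ls t)%:R) - (theta ls)%:C * (size T)%:R|
  <= (theta ls * (2 ^+ size ls - 1) * S)%:C.
Proof.
elim: ls => [|l ls IH] /=.
  move=> _ _ _; rewrite /theta big_nil rmorph1 mul1r subrr mulr0 mul0r rmorph0.
  by rewrite /Lam -sum1_size natr_sum subrr normr0.
move=> /andP[lls us] /andP[lp pls] /andP[lm mls].
have l0 := prime_gt0 lp.
have h1 := IH us pls mls; have h2 := Lam_cop_cons l ls lp lm pls mls lls.
rewrite theta_cons rmorphM.
set a := Lam _ in h2 *; set b := Lam _ in h1 h2.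
have -> : a - (1 - l%:R^-1)%:C * (theta ls)%:C * (size T)%:R =
   (a - (1 - l%:R^-1) * b) + (1 - l%:R^-1) * (b - (theta ls)%:C * (size T)%:R).
  by rewrite rmorphB rmorph1 fmorphV rmorph_nat; ring.
apply: le_trans (ler_normD _ _) _.
have -> : ((1 - l%:R^-1) * theta ls * (2 ^+ (size ls).+1 - 1) * S)%:C =
   ((1 - l%:R^-1) * (theta ls * 2 ^+ size ls * S))%:C +
   ((1 - l%:R^-1) * (theta ls * (2 ^+ size ls - 1) * S))%:C.
  by rewrite -rmorphD exprS; congr (_%:C); ring.
apply: lerD => //.
rewrite normrM norm_one_sub_inv// rmorphM ler_wpM2l// lecR; exact: one_sub_inv_ge0.
Qed.

Lemma normC_real (x y : R) : (`|x%:C| <= y%:C) = (`|x| <= y).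
Proof. by rewrite normc_def /= expr0n addr0 sqrtr_sqr lecR. Qed.

Lemma Lam_count (P : pred nat) : Lam (fun t => (P t)%:R) = ((count P T)%:R : R)%:C.
Proof.
rewrite rmorph_nat /Lam -sum1_count natr_sum [RHS]big_mkcond.
by apply: eq_bigr => t _; case: (P t).
Qed.

Lemma count_cop ls : uniq ls -> all prime ls -> all (fun l => l %| m)%N ls ->
  `|(count (cop ls) T)%:R - theta ls * (size T)%:R : R|
  <= theta ls * (2 ^+ size ls - 1) * S.
Proof.
move=> us pls mls; rewrite -normC_real.
have := Lam_cop ls us pls mls; rewrite Lam_count.
by rewrite -(rmorph_nat (real_complex R)) -rmorphM -rmorphB.
Qed.

Lemma count_cop_cons l ls : prime l -> (l %| m)%N -> all prime ls ->
  all (fun l => l %| m)%N ls -> l \notin ls ->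
  `|(count (cop (l :: ls)) T)%:R - (1 - l%:R^-1) * (count (cop ls) T)%:R : R|
  <= (1 - l%:R^-1) * (theta ls * 2 ^+ size ls * S).
Proof.
move=> lp lm pls mls lls; rewrite -normC_real.
have := Lam_cop_cons l ls lp lm pls mls lls; rewrite !Lam_count.
congr (`|_| <= _); by rewrite rmorphB rmorphM rmorphB rmorph1 fmorphV !rmorph_nat.
Qed.

(** Let K count the exponents prime to the core and A_i those also prime to q_i. If every exponent
    in K were divisible by some q_i, each would be missed by some A_i, so the A_i would add up to at
    most (s - 1) K. But A_i >= (1 - 1/q_i)(K - theta 2^|ls| S), and the weights 1 - 1/q_i add up to
    s - 1 + delta; with the lower bound for K this is a contradiction. *)
Theorem sieve_exists (ls : seq nat) (s : nat) (q : 'I_s -> nat) :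
  uniq ls -> all prime ls -> all (fun l => l %| m)%N ls ->
  (forall i, prime (q i)) -> (forall i, q i %| m)%N -> (forall i, q i \notin ls) ->
  let delta : R := 1 - \sum_(i < s) (q i)%:R^-1 in
  0 <= delta ->
  (s%:R - 1 + delta) * (2 ^+ size ls * S)
    < delta * ((size T)%:R - (2 ^+ size ls - 1) * S) ->
  exists2 t, t \in T & cop ls t && [forall i, ~~ (q i %| t)%N].
Proof.
move=> us pls mls pq mq qls delta d0 hS.
have [/hasP//|/hasPn none] := boolP (has (fun t => cop ls t && [forall i, ~~ (q i %| t)%N]) T).
have th0 : 0 < theta ls.
  rewrite /theta big_seq prodr_gt0// => l lls.
  by rewrite subr_gt0 invf_lt1 ?ltr0n ?ltr1n ?prime_gt1 ?prime_gt0//; move/allP: pls; exact.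
pose K : R := (count (cop ls) T)%:R; pose A i : R := (count (cop (q i :: ls)) T)%:R.
have hK : theta ls * ((size T)%:R - (2 ^+ size ls - 1) * S) <= K.
  have := count_cop ls us pls mls; rewrite -/K ler_norml => /andP[+ _].
  by rewrite lerBrDl; apply: le_trans; rewrite le_eqVlt; apply/orP; left; apply/eqP; ring.
have hA i : (1 - (q i)%:R^-1) * K - (1 - (q i)%:R^-1) * (theta ls * 2 ^+ size ls * S) <= A i.
  have := count_cop_cons (q i) ls (pq i) (mq i) pls mls (qls i).
  by rewrite -/K -/(A i) ler_norml lerBrDl => /andP[].
have hsum : \sum_(i < s) A i <= (s%:R - 1) * K.
  have : (\sum_(i < s) count (cop (q i :: ls)) T + count (cop ls) T <= s * count (cop ls) T)%N.
    rewrite -!sum1_count !(big_mkcond (cop _)) /=.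
    under eq_bigr => i _ do rewrite -sum1_count big_mkcond /=.
    rewrite exchange_big /= -big_split /= big_distrr /= !big_seq; apply: leq_sum => t tT.
    have := none t tT; case: (cop ls t) => /=; last first.
      by move=> _; under eq_bigr => i _ do rewrite andbF; rewrite big1// muln0.
    move=> /forallPn[i0]; rewrite negbK => hi0.
    under eq_bigr => i _ do rewrite andbT.
    rewrite (bigD1 i0)//= hi0 /= add0n muln1.
    have : (\sum_(i < s | i != i0) (if ~~ (q i %| t)%N then 1 else 0) <= \sum_(i < s | i != i0) 1)%N.
      by apply: leq_sum => i _; case: ifP.
    have -> : (\sum_(i < s | i != i0) 1 = s.-1)%N.
      rewrite sum1_card -[in RHS](card_ord s) -(cardC1 i0); apply: eq_card => i; by rewrite !inE.
    have : (0 < s)%N by apply: leq_trans (ltn_ord i0).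
    by move: (\sum_(_ < _ | _) _)%N => z; clear; lia.
  rewrite -(ler_nat R) natrD natr_sum natrM -/K.
  by rewrite mulrBl mul1r lerBrDr.
have hsum2 : \sum_(i < s) ((1 - (q i)%:R^-1) * K - (1 - (q i)%:R^-1) * (theta ls * 2 ^+ size ls * S))
    = (s%:R - 1 + delta) * (K - theta ls * 2 ^+ size ls * S).
  under eq_bigr => i _ do rewrite -mulrBr.
  rewrite -mulr_suml sumrB sumr_const card_ord /delta; congr (_ * _); by ring.
have := le_trans (ler_sum _ (fun i _ => hA i)) hsum; rewrite hsum2 => hfin.
have hd := ler_wpM2l d0 hK.
have := ltr_pM2l th0 ((s%:R - 1 + delta) * (2 ^+ size ls * S)) (delta * ((size T)%:R - (2 ^+ size ls - 1) * S)).
rewrite hS => h2.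
have : (s%:R - 1 + delta) * (K - theta ls * 2 ^+ size ls * S) > (s%:R - 1) * K.
  rewrite -subr_gt0; apply: (@lt_le_trans _ _ (delta * (theta ls * ((size T)%:R - (2 ^+ size ls - 1) * S))
     - theta ls * ((s%:R - 1 + delta) * (2 ^+ size ls * S)))).
    by rewrite subr_gt0 (mulrCA delta).
  apply: le_trans (lerB hd (lexx _)) _.
  by rewrite le_eqVlt; apply/orP; left; apply/eqP; ring.
by rewrite ltNge hfin.
Qed.

End Sieve.

(** * The main theorem *)

Section PrimeDivisors.
Variables (m s : nat) (q : 'I_s -> nat) (k : nat).
Hypotheses (m_gt0 : (0 < m)%N) (q_prime : forall i, prime (q i))
  (k_def : k = prod_smallest_primes (omega m - s) m)
  (rad_eq : radn m = (k * \prod_(i < s) q i)%N).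

Lemma prime_dvd_radn l : prime l -> (l %| radn m)%N = (l \in primes m).
Proof.
move=> lp; rewrite /radn Euclid_dvd_prod// big_has; apply/hasP/idP => [[r rm lr]|lm].
  by move: (rm); rewrite mem_primes => /and3P[rp _ _]; move: lr; rewrite (dvdn_prime2 lp rp) => /eqP ->.
by exists l.
Qed.

Lemma primes_k l : l \in primes k -> l \in primes m.
Proof.
rewrite mem_primes => /and3P[lp _ lk]; rewrite -(prime_dvd_radn l lp) rad_eq.
exact: dvdn_mulr.
Qed.

Lemma k_gt0 : (0 < k)%N.
Proof.
rewrite k_def /prod_smallest_primes big_seq prodn_cond_gt0// => l /mem_take.
by rewrite mem_primes => /andP[/prime_gt0].
Qed.

Lemma q_primes i : q i \in primes m.
Proof.
by rewrite -prime_dvd_radn// rad_eq (bigD1 i)//= mulnCA dvdn_mulr.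
Qed.

(** Otherwise the square of [q i] would divide the radical, a product of distinct primes. *)
Lemma q_notin_k i : q i \notin primes k.
Proof.
apply/negP; rewrite mem_primes => /and3P[_ _ qk].
have h : (q i * q i %| radn m)%N.
  by rewrite rad_eq (bigD1 i)//= dvdn_mul// dvdn_mulr.
move: h; rewrite /radn (perm_big _ (perm_to_rem (q_primes i))) big_cons.
rewrite dvdn_pmul2l ?prime_gt0//; apply/negP; apply: prime_ndvd_prod => //.
  by apply/allP => l /mem_rem; rewrite mem_primes => /andP[].
by rewrite mem_rem_uniq ?primes_uniq// inE eqxx.
Qed.

Lemma prime_dvd_cases l : prime l -> (l %| m)%N -> l \in primes k \/ exists i, l = q i.
Proof.
move=> lp lm; have : (l %| radn m)%N by rewrite prime_dvd_radn// mem_primes lp m_gt0.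
rewrite rad_eq Euclid_dvdM// => /orP[lk|]; first by left; rewrite mem_primes lp k_gt0.
rewrite Euclid_dvd_prod// big_orE => /exists_inP[i _]; rewrite (dvdn_prime2 lp (q_prime i)) => /eqP ->.
by right; exists i.
Qed.

End PrimeDivisors.

Section Existence.
Context {R : realType}.
Local Notation C := R[i].

Lemma sqf_primitive_root_exists (p s : nat) (q : 'I_s -> nat) (k X K : nat) (B D : R) :
  prime p -> (forall i, prime (q i)) ->
  k = prod_smallest_primes (omega p.-1 - s) p.-1 ->
  radn p.-1 = (k * \prod_(i < s) q i)%N ->
  (X < p)%N -> 0 < B -> 0 < D -> (K ^ 2 <= X < K.+1 ^ 2)%N -> X%:R <= D ^+ 2 * B ->
  (forall chi : 'F_p -> C, (forall a b, chi (a * b) = chi a * chi b) ->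
     (forall a, a != 0 -> `|chi a| = 1) -> chi 0 = 0 -> \sum_a chi a = 0 ->
     forall N, (N < p)%N -> `|\sum_(1 <= i < N.+1) chi i%:R| <= B%:C) ->
  let S := B * \sum_(1 <= e < K.+1 | sqf e) decay R D e in
  0 <= sieve_delta R q ->
  (s%:R - 1 + sieve_delta R q) * (2 ^+ omega k * S) < sieve_delta R q *
    ((\sum_(1 <= n < X.+1 | sqf n) 1)%N%:R - (2 ^+ omega k - 1) * S) ->
  exists n : nat, [/\ primitive_root_mod p n, squarefree n & (n <= X)%N].
Proof.
move=> p_prime q_prime k_def rad_eq Xp B0 D0 hK hX PV S d0 hS.
have [g gP] := primitive_root_exists p p_prime.
have m0 := prim_order_gt0 gP.
pose ns := [seq n <- index_iota 1 X.+1 | sqf n].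
pose T := [seq ind p g n%:R | n <- ns].
have nz n : n \in ns -> ~~ (p %| n)%N.
  rewrite mem_filter mem_index_iota => /and3P[_ n1 nX]; apply/negP => /(dvdn_leq n1).
  by rewrite leqNgt (leq_trans nX).
(* An additive character of the discrete logarithm is a Dirichlet character, so the sieve hypothesis
   is the bound T for squarefree character sums. *)
have Lpsi j : ~~ (p.-1 %| j)%N -> `|Lam T (psi (R := R) p.-1 j)| <= S%:C.
  move=> hj; pose chi := dchar (R := R) p g j.
  have -> : Lam T (psi p.-1 j) = \sum_(1 <= n < X.+1 | sqf n) chi n%:R.
    rewrite /Lam big_map -[RHS]big_filter big_seq [RHS]big_seq.
    by apply: eq_bigr => n /nz; rewrite -(Fp_nat_eq0 p p_prime) => nn; rewrite /chi /dchar (negPf nn).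
  apply: norm_sum_sqf_chi_le => //.
  - by move=> a b; exact: dcharM.
  - by move=> a; exact: dchar_le1.
  - apply: PV; [by move=> a b; exact: dcharM|by move=> a; exact: norm_dchar|exact: dchar0|exact: sum_dchar].
have sT : size T = (\sum_(1 <= n < X.+1 | sqf n) 1)%N.
  by rewrite size_map -sum1_size big_filter.
have ls_div : all (fun l => l %| p.-1)%N (primes k).
  apply/allP => l lk; have := primes_k _ _ _ _ rad_eq l lk.
  by rewrite mem_primes => /and3P[].
have ls_prime : all prime (primes k) by apply/allP => l; rewrite mem_primes => /andP[].
have q_div i : (q i %| p.-1)%N.
  by have := q_primes _ _ _ _ q_prime rad_eq i; rewrite mem_primes => /and3P[].
have q_ls i : q i \notin primes k by exact: (q_notin_k p.-1 s q k q_prime rad_eq).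
rewrite -sT in hS.
have [t] := sieve_exists (R := R) p.-1 T S m0 Lpsi (primes k) s q (primes_uniq k)
  ls_prime ls_div q_prime q_div q_ls d0 hS.
move=> /mapP[n nns ->] /andP[hc /forallP hq].
exists n; split.
- apply: (primitive_root_of_ind p p_prime g gP); first exact: nz.
  move=> l lp lm; have [lk|[i ->]] := prime_dvd_cases _ _ _ _ m0 q_prime k_def rad_eq l lp lm.
    by move/allP: hc; exact.
  exact: hq.
- move: nns; rewrite mem_filter mem_index_iota => /and3P[sn n1 _].
  by split => //; exact/sqfP.
- by move: nns; rewrite mem_filter mem_index_iota ltnS => /and3P[].
Qed.

End Existence.

Section FinalInequality.
Variable R : realFieldType.

(* In the application D = d^2, B = b^2 and x = D^2 B, while W is
   2^omega(k) Delta and t is sqrt 2. *)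
Lemma final_inequality (kap W d b t Y S N : R) :
  59 / 100 <= kap <= 1 -> 2 <= W -> 1 <= d -> 5 <= b -> t <= 1416 / 1000 ->
  2 * d ^+ 2 * b ^+ 2 + b ^+ 2 - d ^+ 2 * b + 32 / 10 * d * b ^+ 2 <= Y ->
  (W + 1) * Y < d ^+ 4 * b ^+ 2 ->
  S <= b ^+ 2 * (kap * (2 * d ^+ 2 - d ^+ 2 / b) + (4 / 3 * (t * d) + 2)) ->
  kap * (d ^+ 4 * b ^+ 2 - 1) - 2 * (d ^+ 2 * b) <= N ->
  (W - 1) * S < N.
Proof.
move=> /andP[k1 k2] W2 d1 b5 t2 hY hG hS hN.
have b0 : 0 < b by lra.
set D := d ^+ 2 in hY hS hN.
have D1 : 1 <= D by rewrite /D expr_ge1//; lra.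
have dD : d ^+ 4 = D ^+ 2 by rewrite /D -exprM.
rewrite dD in hG hN.
set Q := D * b ^+ 2.
have Q0 : 25 <= Q by rewrite /Q; nra.
have DbQ : D * b <= Q / 5.
  rewrite /Q -subr_ge0; have -> : D * b ^+ 2 / 5 - D * b = D * b * ((b - 5) / 5) by field.
  by apply: mulr_ge0; [apply: mulr_ge0 | ]; clear -D1 b5; lra.
have b2 : 25 <= b ^+ 2 by nra.
have bQ : b ^+ 2 <= Q by rewrite /Q; nra.
have db0 : 0 <= d * b ^+ 2 by apply: mulr_ge0; [lra | exact: sqr_ge0].
have Yl : 18 / 10 * Q + b ^+ 2 <= Y.
  apply: le_trans hY; have -> : 2 * D * b ^+ 2 = 2 * Q by rewrite /Q; ring.
  have -> : 32 / 10 * d * b ^+ 2 = 32 / 10 * (d * b ^+ 2) by ring.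
  lra.
(* The hypothesis also bounds W by D, which keeps the W-fold loss (2 - kap) b^2 below a multiple of
   Q. *)
have W1 : (W + 1) * (18 / 10) < D.
  have : (W + 1) * (18 / 10 * Q) < D * Q.
    apply: le_lt_trans (_ : (W + 1) * Y < _); first by apply: ler_wpM2l; [clear -W2; lra | clear -Yl b2; lra].
    by apply: lt_le_trans hG _; rewrite /Q mulrA -expr2.
  by rewrite mulrA ltr_pM2r//; lra.
have S1 : S <= kap * Y + (2 - kap) * b ^+ 2.
  apply: le_trans hS _.
  have -> : b ^+ 2 * (kap * (2 * D - D / b) + (4 / 3 * (t * d) + 2)) =
    kap * (2 * D * b ^+ 2 - D * b) + 4 / 3 * t * (d * b ^+ 2) + 2 * b ^+ 2.
    by field; rewrite gt_eqF.
  (* The constants meet exactly: 4/3 times 1.416 and 0.59 times 3.2 are both 1.888. *)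
  have h1 : 4 / 3 * t * (d * b ^+ 2) <= kap * (32 / 10) * (d * b ^+ 2).
    by apply: ler_wpM2r => //; lra.
  have h2 := ler_wpM2l (_ : 0 <= kap) hY; have {}h2 := h2 ltac:(lra).
  lra.
have h3 : (W - 1) * S <= (W - 1) * (kap * Y + (2 - kap) * b ^+ 2).
  by apply: ler_wpM2l; [clear -W2; lra | ].
have h4 : (W - 1) * ((2 - kap) * b ^+ 2) <= 8 / 10 * Q.
  have : (W - 1) * (2 - kap) <= 8 / 10 * D.
    have : (W - 1) * (2 - kap) <= (W - 1) * (141 / 100).
      by apply: ler_wpM2l; [clear -W2; lra | clear -k1; lra].
    by clear -W1 W2; lra.
  move=> h; rewrite /Q (mulrA (W - 1)) (mulrA (8 / 10)).
  by apply: ler_wpM2r => //; clear -b2; lra.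
have h5 : kap * ((W + 1) * Y) < kap * (D ^+ 2 * b ^+ 2) by rewrite ltr_pM2l//; lra.
(* The surplus 2 kap Y is at least 2.12 Q. It covers 0.8 Q from [h4], 0.4 Q from 2 D b, and the
   rounding term kap. *)
have h6 : 118 / 100 * (18 / 10 * Q + b ^+ 2) <= 2 * kap * Y.
  by apply: ler_pM; [ | clear -Q0 b2 | clear -k1 | exact: Yl]; lra.
apply: le_lt_trans h3 _; apply: lt_le_trans hN.
have -> : (W - 1) * (kap * Y + (2 - kap) * b ^+ 2) = kap * ((W + 1) * Y) - 2 * kap * Y + (W - 1) * ((2 - kap) * b ^+ 2) by ring.
by clear -h4 h5 h6 DbQ Q0 b2 k2; lra.
Qed.

End FinalInequality.

Section Logarithms.
Variable R : realType.

Lemma ln_100_ge : 4 <= ln 100 :> R.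
Proof.
have h : ln ((3 / 4) ^+ 16) <= - 4 :> R.
  rewrite lnXn; last lra.
  have := @le_ln1Dx R (- (1 / 4)); have -> : 1 + - (1 / 4) = 3 / 4 :> R by lra.
  by move=> /(_ ltac:(lra)); move: (ln _) => u; lra.
have : ln (100^-1) <= ln ((3 / 4) ^+ 16) :> R.
  have a : 100^-1 <= (3 / 4) ^+ 16 :> R by lra.
  have b : 0 < (3 / 4) ^+ 16 :> R by lra.
  by rewrite ler_ln ?posrE ?invr_gt0.
by move=> h2; have h3 := le_trans h2 h; rewrite lnV ?posrE// in h3; clear -h3; lra.
Qed.

Lemma ln_5_le : ln 5 <= 1784 / 1000 :> R.
Proof.
have h : ln ((1223 / 1000) ^+ 8) <= 1784 / 1000 :> R.
  rewrite lnXn; last lra.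
  have := @le_ln1Dx R (223 / 1000); have -> : 1 + 223 / 1000 = 1223 / 1000 :> R by lra.
  by move=> /(_ ltac:(lra)); move: (ln _) => u; lra.
apply: le_trans h.
have a : 5 <= (1223 / 1000) ^+ 8 :> R by lra.
by rewrite ler_ln ?posrE//; apply: lt_le_trans a.
Qed.

(* With u = p^(1/8) and be = (c log p)^(1/4) this says log p <= 0.45 B^(3/4). *)
Lemma ln_le_cube (u be : R) : 100 <= u ^+ 8 -> 0 < u -> 0 < be -> 266 / 100 <= be ^+ 4 ->
  ln (u ^+ 8) <= 45 / 100 * (u * be) ^+ 3.
Proof.
move=> hu u0 be0 hbe.
have be1 : 127 / 100 <= be.
  rewrite leNgt; apply/negP => h.
  have : be ^+ 4 < (127 / 100) ^+ 4 by rewrite ltr_pXn2r// nnegrE ltW//; lra.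
  lra.
have be3 : 204 / 100 <= be ^+ 3.
  have : (127 / 100) ^+ 3 <= be ^+ 3 by rewrite lerXn2r ?nnegrE ?(ltW be0)//; lra.
  lra.
have u1 : 177 / 100 <= u.
  rewrite leNgt; apply/negP => h.
  have : u ^+ 8 < (177 / 100) ^+ 8 by rewrite ltr_pXn2r// nnegrE ltW//; lra.
  lra.
have u3 : 55 / 10 <= u ^+ 3.
  have : (177 / 100) ^+ 3 <= u ^+ 3 by rewrite lerXn2r ?nnegrE ?(ltW u0)//; lra.
  lra.
(* The tangent to the logarithm at 5, close to the least value 5.5 of u^3. *)
have lnu : ln (u ^+ 3) <= u ^+ 3 / 5 + 784 / 1000.
  have -> : u ^+ 3 = 5 * (1 + (u ^+ 3 / 5 - 1)) by field.
  rewrite lnM ?posrE//; last lra.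
  have := @le_ln1Dx R (u ^+ 3 / 5 - 1); have h5 := ln_5_le.
  move=> /(_ ltac:(lra)); move: (ln _) (ln _) h5 => x y; lra.
rewrite !lnXn// in lnu *; rewrite exprMn.
have : u ^+ 3 * (204 / 100) <= u ^+ 3 * be ^+ 3 by rewrite ler_pM2l// exprn_gt0.
by clear -lnu u3; move: (ln u) (u ^+ 3) (be ^+ 3) lnu u3 => x y z; lra.
Qed.

End Logarithms.

(** * The hypothesis on G in polynomial form *)

Section Constants.
Context {R : realType}.

Lemma powRX (a t : R) n : 0 <= a -> (a `^ t) ^+ n = a `^ (t * n%:R).
Proof. by move=> a0; rewrite -powR_mulrn ?powR_ge0// -powRrM. Qed.

(** Here z = pi, u = p^(1/8), g = c^(1/4), l = (log p)^(1/4) and d = D^(1/2), so that u g l =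
    B^(1/4) and d u g l = x^(1/4). With letters for these roots, multiplying G by x^(1/2) p^(1/4) is
    a rational identity. *)
Lemma const_G_normal_form (F : realFieldType) (z d u g l A W : F) :
  0 < z -> 0 < d -> 0 < u -> 0 < g -> 0 < l -> 0 < d ^+ 2 - 1 ->
  (d * (u * (g * l))) ^+ 2 * u ^+ 2 *
  ((d * (u * (g * l))) ^+ 2 / u ^+ 2 -
   z ^+ 2 / 6 *
   (104 / 10 ^+ 3 / u ^+ 2 +
    (W + 1) *
    (l ^+ 2 *
     (6 / z ^+ 2 *
      (g ^+ 2 + d ^+ 2 / (d ^+ 2 - 1) * g ^+ 2 - u ^- 2 / l ^+ 2) +
      A *
      (u / (d * (u * (g * l))) * g ^+ 3 * l -
       1 / 3 * (u ^- 2 / (d * (u * (g * l)))) * l ^+ 2 +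
       7 / 3 * (u / (d * (u * (g * l)))) * l * g ^+ 3))))) =
  (d * (u * (g * l))) ^+ 4 -
  z ^+ 2 / 6 * (104 / 10 ^+ 3) * (d * (u * (g * l))) ^+ 2 -
  (W + 1) *
  (d ^+ 2 * (u * (g * l)) ^+ 4 * (1 + d ^+ 2 / (d ^+ 2 - 1)) -
   d ^+ 2 * (u * (g * l)) ^+ 2 +
   z ^+ 2 / 6 * A *
   (10 / 3 * (d * (u * (g * l)) ^+ 4) -
    1 / 3 * (d * (u * (g * l)) * l ^+ 4))).
Proof.
by move=> z0 d0 u0 g0 l0 dd; field; rewrite !gt_eqF.
Qed.

(* The coefficient 3.2 is a lower bound for
   (pi^2/6) A (10/3 - log p / (3 B^(3/4))). *)
Lemma const_G_unfold (p : nat) (alpha W : R) : (100 < p)%N -> 1 < const_D p alpha -> 0 <= W ->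
  0 < xpow p alpha `^ (1 / 2) * p%:R `^ (- (1 / 4))
      - pi ^+ 2 / 6 * (104 / 10 ^+ 3 / p%:R `^ (1 / 4) + (W + 1) * const_E p alpha) ->
  exists d b : R, [/\ 1 <= d, 5 <= b,
    b ^+ 2 = Num.sqrt p%:R * ((ln p%:R + 6) / (pi * Num.sqrt 2) + 1),
    xpow p alpha = d ^+ 4 * b ^+ 2 &
    (W + 1) * (2 * d ^+ 2 * b ^+ 2 + b ^+ 2 - d ^+ 2 * b + 32 / 10 * d * b ^+ 2)
      < d ^+ 4 * b ^+ 2].
Proof.
move=> p100 D1 W0 hG0.
have P100 : 100 <= p%:R :> R by rewrite ler_nat ltnW.
set P : R := p%:R in P100 *.
have P0 : 0 < P by lra.
set L := ln P.
have L4 : 4 <= L by apply: le_trans (ln_100_ge R) _; rewrite ler_ln ?posrE.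
have pi0 := pi_gt0 R; have s20 : 0 < Num.sqrt 2 :> R by rewrite sqrtr_gt0.
have ps0 : 0 < pi * Num.sqrt 2 :> R by rewrite mulr_gt0.
have cL : const_c R p * L = (L + 6) / (pi * Num.sqrt 2) + 1.
  rewrite /const_c -/P -/L; move: (ps0); move: (pi * _) => z z0.
  by field; rewrite !gt_eqF//; lra.
(* From log p >= 4 and 1/(pi sqrt 2) >= 1/6: the value is at least 10/6 + 1. *)
have cL_ge : 266 / 100 <= const_c R p * L.
  rewrite cL; have := inv_pi_sqrt2_ge (R := R); move: ((pi * Num.sqrt 2)^-1) => z hz.
  have : 10 * 6^-1 <= (L + 6) * z by apply: ler_pM => //; lra.
  lra.
have L0 : 0 < L by lra.
have c0 : 0 < const_c R p by rewrite -(pmulr_lgt0 _ L0); lra.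
set c := const_c R p in c0 cL cL_ge *.
set u := P `^ (1 / 8); set y := P `^ (alpha / 4); set l := L `^ (1 / 4); set ga := c `^ (1 / 4).
have u0 : 0 < u by exact: powR_gt0.
have y0 : 0 < y by exact: powR_gt0.
have l0 : 0 < l by exact: powR_gt0.
have ga0 : 0 < ga by exact: powR_gt0.
have u8 : u ^+ 8 = P by rewrite powRX ?ltW// -[RHS]powRr1 ?ltW//; congr (_ `^ _); field.
have u2 : P `^ (1 / 4) = u ^+ 2 by rewrite powRX ?ltW//; congr (_ `^ _); field.
have l4 : l ^+ 4 = L by rewrite powRX ?ltW// -[RHS]powRr1 ?ltW//; congr (_ `^ _); field.
have l2 : L `^ (1 / 2) = l ^+ 2 by rewrite powRX ?ltW//; congr (_ `^ _); field.
have g4 : ga ^+ 4 = c by rewrite powRX ?ltW// -[RHS]powRr1 ?ltW//; congr (_ `^ _); field.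
have g2 : c `^ (1 / 2) = ga ^+ 2 by rewrite powRX ?ltW//; congr (_ `^ _); field.
have g3 : c `^ (3 / 4) = ga ^+ 3 by rewrite powRX ?ltW//; congr (_ `^ _); field.
have x4 : xpow p alpha = y ^+ 4 by rewrite /xpow powRX ?ltW//; congr (_ `^ _); field.
have x2 : xpow p alpha `^ (1 / 2) = y ^+ 2 by rewrite /xpow powRX ?ltW// -powRrM; congr (_ `^ _); field.
have r4 : Num.sqrt P = u ^+ 4.
  by rewrite -u8 (_ : u ^+ 8 = (u ^+ 4) ^+ 2) ?sqrtr_sqr ?ger0_norm ?exprn_ge0 ?ltW// -exprM.
have um : P `^ (1 / 8 - alpha / 4) = u / y by rewrite powRB// (gt_eqF P0); case: (_ == _).
have um2 : P `^ (- (1 / 4) - alpha / 4) = (u ^+ 2)^-1 / y 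
  by rewrite powRB ?powRN ?u2// (gt_eqF P0); case: (_ == _).
set v := u * (ga * l).
have v0 : 0 < v by rewrite !mulr_gt0.
have v4 : v ^+ 4 = Num.sqrt P * (c * L) by rewrite /v !exprMn r4 g4 l4.
have D2 : const_D p alpha = (y / v) ^+ 2.
  rewrite /const_D x4 -/P -/c -/L.
  have -> : c * Num.sqrt P * L = v ^+ 4 by rewrite v4; ring.
  rewrite -expr_div_n.
  rewrite div1r powR12_sqrt; last by rewrite exprn_ge0// divr_ge0 ?ltW.
  have -> : (y / v) ^+ 4 = ((y / v) ^+ 2) ^+ 2 by rewrite -exprM.
  by rewrite sqrtr_sqr ger0_norm ?sqr_ge0.
have yv0 : 0 < y / v by rewrite divr_gt0.
have L_le : L <= 45 / 100 * v ^+ 3.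
  have := @ln_le_cube R u (ga * l); rewrite u8 exprMn g4 l4 => h.
  by apply: h => //; rewrite mulr_gt0.
exists (y / v), (v ^+ 2).
have e4 : (y / v) ^+ 4 * (v ^+ 2) ^+ 2 = y ^+ 4 by field; rewrite gt_eqF.
split.
- rewrite leNgt; apply/negP => h; move: D1; rewrite D2 ltNge exprn_ile1// ltW//.
- rewrite leNgt; apply/negP => h.
  have : (v ^+ 2) ^+ 2 < 5 ^+ 2 by rewrite ltr_pXn2r// nnegrE ?sqr_ge0.
  rewrite -exprM v4 => h2.
  have : 10 * (266 / 100) <= Num.sqrt P * (c * L).
    apply: ler_pM => //; first lra.
    have -> : 10 = Num.sqrt (10 ^+ 2) :> R by rewrite sqrtr_sqr ger0_norm.
    by rewrite ler_sqrt//; lra.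
  by move: h2; clear; lra.
- by rewrite -exprM v4 cL.
- by rewrite x4 e4.
move: hG0; rewrite x2 powRN u2 /const_E; cbv zeta.
rewrite -/P -/L -/c g2 l2 g3 um um2 powRN u2 powRN l2 -/l.
have Dh : const_Dhat p alpha = (y / v) ^+ 2 / ((y / v) ^+ 2 - 1) by rewrite /const_Dhat D2.
rewrite {}Dh; move: D1; rewrite {}D2; rewrite e4; set d := y / v => D1 hG.
have yd : y = d * v by rewrite /d mulfVK// gt_eqF.
set A := const_A R in hG *.
set E1 := d ^+ 2 * v ^+ 4 * (1 + d ^+ 2 / (d ^+ 2 - 1)) - d ^+ 2 * v ^+ 2
   + pi ^+ 2 / 6 * A * (10 / 3 * (d * v ^+ 4) - 1 / 3 * (d * v * L)).
have hE : 0 < y ^+ 4 - pi ^+ 2 / 6 * (104 / 10 ^+ 3) * y ^+ 2 - (W + 1) * E1.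
  have yu0 : 0 < y ^+ 2 * u ^+ 2 by rewrite mulr_gt0 ?exprn_gt0.
  have := mulr_gt0 yu0 hG; congr (_ < _).
  rewrite /E1 -l4 yd /v; apply: const_G_normal_form => //.
  by rewrite subr_gt0.
(* Already pi >= 3 gives 1.5 A > 1.01. *)
have A1 : 101 / 100 <= pi ^+ 2 / 6 * A.
  have pi3 := pi_ge3 (R := R); have : 9 <= pi ^+ 2 :> R by nra.
  rewrite /A /const_A; move: (pi ^+ 2) => z hz; nra.
have Y_le : 2 * d ^+ 2 * (v ^+ 2) ^+ 2 + (v ^+ 2) ^+ 2 - d ^+ 2 * v ^+ 2 + 32 / 10 * d * (v ^+ 2) ^+ 2 <= E1.
  rewrite -!exprM /E1.
  have dd : 0 < d ^+ 2 - 1 by lra.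
  (* The excess of the factor D/(D - 1) over 1 yields D B/(D - 1), which is at least B: this is the
     lone b^2 in the bound. *)
  have -> : d ^+ 2 / (d ^+ 2 - 1) = 1 + (d ^+ 2 - 1)^-1 by field; rewrite gt_eqF.
  have v40 : 0 < v ^+ 4 by rewrite exprn_gt0.
  have h1 : v ^+ 4 <= d ^+ 2 * v ^+ 4 * (d ^+ 2 - 1)^-1.
    rewrite mulrAC -[leLHS]mul1r ler_pM2r// ler_pdivlMr//; lra.
  have h2 : d * v * L <= 45 / 100 * (d * v ^+ 4).
    have -> : 45 / 100 * (d * v ^+ 4) = d * v * (45 / 100 * v ^+ 3) by ring.
    by rewrite ler_pM2l// mulr_gt0.
  have dv0 : 0 <= d * v ^+ 4 by rewrite mulr_ge0// ltW.
  (* Numerically 1.01 (10/3 - 0.45/3) > 3.2. *)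
  have h3 : 32 / 10 * (d * v ^+ 4) <= pi ^+ 2 / 6 * A * (10 / 3 * (d * v ^+ 4) - 1 / 3 * (d * v * L)).
    apply: le_trans (_ : 101 / 100 * (10 / 3 * (d * v ^+ 4) - 1 / 3 * (d * v * L)) <= _).
      lra.
    by apply: ler_wpM2r => //; lra.
  move: h3; set T1 := _ * (10 / 3 * _ - _) => h3.
  have -> : 2 * d ^+ 2 * v ^+ (2 * 2) + v ^+ (2 * 2) - d ^+ 2 * v ^+ 2 + 32 / 10 * d * v ^+ (2 * 2)
    = 2 * (d ^+ 2 * v ^+ 4) + v ^+ 4 - d ^+ 2 * v ^+ 2 + 32 / 10 * (d * v ^+ 4) by ring.
  have -> : d ^+ 2 * v ^+ 4 * (1 + (1 + (d ^+ 2 - 1)^-1)) =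
    2 * (d ^+ 2 * v ^+ 4) + d ^+ 2 * v ^+ 4 * (d ^+ 2 - 1)^-1 by ring.
  by clear -h1 h3; lra.
have y20 : 0 <= pi ^+ 2 / 6 * (104 / 10 ^+ 3) * y ^+ 2.
  apply: mulr_ge0; last exact: sqr_ge0.
  by apply: mulr_ge0; [rewrite divr_ge0// sqr_ge0 | clear; lra].
have := ler_wpM2l (_ : 0 <= W + 1) Y_le; move=> /(_ ltac:(lra)).
move: hE y20; move: ((W + 1) * _) ((W + 1) * _) (_ * y ^+ 2) (y ^+ 4) => s1 s2 s3 s4.
lra.
Qed.

End Constants.

Lemma nat_sqrt_exists (X : nat) : exists K, (K ^ 2 <= X < K.+1 ^ 2)%N.
Proof.
elim: X => [|X [K hK]]; first by exists 0%N.
have [h|h] := leqP (K.+1 ^ 2) X.+1; [exists K.+1|exists K]; lia.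
Qed.

(** The root must be strictly below x, so an integral x calls for X = x - 1; in every case X >= x -
    1. *)
Lemma strict_floor {R : realType} (x : R) : 1 < x ->
  exists X : nat, X%:R < x <= X.+1%:R.
Proof.
move=> x1; have x0 : 0 <= x by lra.
have /andP[h1 h2] := truncn_itv x0.
move: h1; rewrite le_eqVlt => /predU1P[e|h1]; last by exists (Num.truncn x); rewrite h1 ltW.
exists (Num.truncn x).-1; rewrite prednK; last by rewrite -(ltr_nat R) e; lra.
rewrite e lexx andbT -[X in _ < X]e ltr_nat; have : (0 < Num.truncn x)%N by rewrite -(ltr_nat R) e; lra.
lia.
Qed.

Theorem mainTheorem6 (R : realType) (p : nat) (alpha : R)
    (s : nat) (q : 'I_s -> nat) (k : nat)
    (p_prime : prime p) (p_gt100 : (100 < p)%N)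
    (alpha_gt0 : 0 < alpha) (alpha_lt1 : alpha < 1)
    (s_ge1 : (1 <= s)%N) (s_le : (s <= omega p.-1)%N)
    (q_prime : forall i, prime (q i)) (q_inj : injective q)
    (k_def : k = prod_smallest_primes (omega p.-1 - s) p.-1)
    (rad_eq : radn p.-1 = (k * \prod_(i < s) q i)%N)
    (delta_gt0 : 0 < sieve_delta R q)
    (D_gt1 : 1 < const_D p alpha)
    (G_gt0 : 0 < const_G p alpha q k) :
  exists n : nat,
    [/\ primitive_root_mod p n, squarefree n & n%:R < xpow p alpha].
Proof.
have s1 : 1 <= s%:R :> R by rewrite ler1n.
have Delta2 : 2 <= sieve_Delta R q by rewrite /sieve_Delta lerDr divr_ge0 ?(ltW delta_gt0)// subr_ge0.
have W2 : 2 <= 2 ^+ omega k * sieve_Delta R q.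
  apply: (le_trans Delta2); apply: ler_peMl; [exact: (le_trans _ Delta2) | by rewrite exprn_ege1// ler1n].
have [d [b [d1 b5 bE xE hY]]] := @const_G_unfold R p alpha _ p_gt100 D_gt1 (le_trans (ler0n _ 2) W2) G_gt0.
have b0 : 0 < b by lra.
have d0 : 0 < d by lra.
have P1 : 1 < p%:R :> R by rewrite ltr1n prime_gt1.
have xp : xpow p alpha < p%:R.
  rewrite -[X in _ < X]powRr1 ?ltW//; last lra.
  by rewrite /xpow /powR !gt_eqF; try lra; rewrite ltr_expR ltr_pM2r// ln_gt0.
have x1 : 1 < d ^+ 4 * b ^+ 2.
  have : 1 <= d ^+ 4 by rewrite expr_ge1// ltW.
  by move: (d ^+ 4) => z z1; nra.
have [X /andP[Xx xX]] := strict_floor _ x1.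
have [K hK] := nat_sqrt_exists X.
have Xp : (X < p)%N by rewrite -(ltr_nat R); apply: lt_trans Xx _; rewrite -xE.
have D0 : 0 < d ^+ 2 by rewrite exprn_gt0.
have B0 : 0 < b ^+ 2 by rewrite exprn_gt0.
have hX : X%:R <= (d ^+ 2) ^+ 2 * b ^+ 2 by rewrite -exprM ltW.
have db0 : 0 < d ^+ 2 * b by rewrite mulr_gt0.
have sqx : d ^+ 4 * b ^+ 2 = (d ^+ 2 * b) ^+ 2 by rewrite exprMn -exprM.
case/andP: (hK) => K1 K2.
have Kx : K%:R < d ^+ 2 * b :> R.
  rewrite -(@ltr_pXn2r _ 2) ?nnegrE ?(ltW db0)// -sqx.
  by apply: le_lt_trans Xx; rewrite -natrX ler_nat.
have xK : d ^+ 2 * b <= K.+1%:R :> R.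
  rewrite -(@ler_pXn2r _ 2) ?nnegrE ?(ltW db0)// -sqx.
  by apply: le_trans xX _; rewrite -natrX ler_nat.
(* Here K >= D b - 1 >= 5 D - 1 >= D, so the range of summation passes the change of branch. *)
have DK : d ^+ 2 <= K%:R.
  rewrite -natr1 in xK; have : 1 <= d ^+ 2 by rewrite expr_ge1// ltW.
  by move: (d ^+ 2) xK => z xK z1; nra.
have K0 : 0 < K%:R :> R by apply: lt_le_trans DK.
pose t : R := Num.sqrt 2.
have t0 : 0 < t by rewrite sqrtr_gt0.
have t2 : t ^+ 2 = 2 by rewrite sqr_sqrtr.
have t_le : t <= 1416 / 1000.
  rewrite leNgt; apply/negP => h.
  have : (1416 / 1000) ^+ 2 < t ^+ 2 by rewrite ltr_pXn2r// nnegrE ltW//; lra.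
  by rewrite t2; lra.
have p29 : (29 <= p)%N by apply: leq_trans p_gt100.
have kap1 := kappa_ge R p p29; have kap2 := kappa_le1 R p.
have Kp : (K <= p)%N.
  by apply: leq_trans (ltnW Xp); apply: leq_trans K1; rewrite -{1}(expn1 K) leq_pexp2l// -(ltr_nat R).
have td0 : 0 < t * d by rewrite mulr_gt0.
have hS := @sum_sqf_decay_cut R p K (d ^+ 2) (t * d) p29 Kp.
rewrite D0 DK in hS; have {}hS := hS isT td0.
(* Since K < x^(1/2) = D b, the second-order saving D^2/K is at least D/b. *)
have cut : (d ^+ 2) ^+ 2 / K%:R >= d ^+ 2 / b.
  rewrite ler_pdivlMr// -[leLHS]mulrA [(d ^+ 2) ^+ 2]expr2 ler_pM2l// mulrC ler_pdivrMr//.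
  exact: ltW.
have {}hS : \sum_(1 <= n < K.+1 | sqf n) decay R (d ^+ 2) n
    <= kappa p R * (2 * d ^+ 2 - d ^+ 2 / b) + (4 / 3 * (t * d) + 2).
  have hc : 2 * d ^+ 2 - d ^+ 2 ^+ 2 / K%:R <= (t * d) ^+ 2.
    by rewrite [(t * d) ^+ 2]exprMn t2 gerBl divr_ge0 ?sqr_ge0.
  apply: le_trans (hS hc) _.
  by rewrite lerD2r; apply: ler_wpM2l; [lra | rewrite lerD2l lerN2].
have hN := @sum_sqf_count_ge R p X (d ^+ 2 * b) (ltnW Xp) db0.
rewrite -sqx in hN; have {}hN := hN (ltW Xx).
have key := @final_inequality R (kappa p R) (2 ^+ omega k * sieve_Delta R q) d b t _
  (b ^+ 2 * \sum_(1 <= e < K.+1 | sqf e) decay R (d ^+ 2) e)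
  ((\sum_(1 <= n < X.+1 | sqf n) 1)%N%:R) _ W2 d1 b5 t_le (lexx _) hY.
have {}key := key ltac:(by rewrite kap1 kap2) ltac:(by rewrite ler_pM2l).
have {}key := key ltac:(by apply: le_trans hN; rewrite lerD2r ler_wpM2l//; [lra | rewrite lerBlDr natr1]).
have PV (chi : 'F_p -> R[i]) : (forall a c, chi (a * c) = chi a * chi c) ->
     (forall a, a != 0 -> `|chi a| = 1) -> chi 0 = 0 -> \sum_a chi a = 0 ->
     forall N, (N < p)%N -> `|\sum_(1 <= i < N.+1) chi i%:R| <= (b ^+ 2)%:C.
  move=> chiM chi1 chi0 chis N Np; rewrite bE.
  exact: (polya_vinogradov p p_prime p_gt100 chi chiM chi1 chi0 chis N Np).
have [|n [n1 n2 n3]] := sqf_primitive_root_exists p s q k X K (b ^+ 2) (d ^+ 2)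
  p_prime q_prime k_def rad_eq Xp B0 D0 hK hX PV (ltW delta_gt0).
  move: key; set S := b ^+ 2 * _; set N1 := _%:R => key.
  have := key; rewrite -(ltr_pM2l delta_gt0); set w := 2 ^+ omega k.
  rewrite /sieve_Delta; move: delta_gt0; move: (sieve_delta R q) => de de0.
  (* As delta Delta = (s - 1 + delta) + delta, the sieve condition is delta times (2^omega(k) Delta
     - 1) S < N. *)
  have -> : de * ((w * ((s%:R - 1) / de + 2) - 1) * S) =
     (s%:R - 1 + de) * (w * S) + de * ((w - 1) * S) by field; rewrite gt_eqF.
  by rewrite mulrBr ltrBrDr.
exists n; split => //; rewrite xE; apply: le_lt_trans Xx.
by rewrite ler_nat.
Qed.
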